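(* Let $(\mathcal{X},\mathcal{A},P)$ be a probability space, $f\in L_2(P)$ real-valued, and $h=(h_1,\ldots,h_m)^T$ control variates $h_j\in L_2(P)$ with $P(h_j)=0$. Fix a minimizer $\beta^\star(f)\in\arg\min_{\beta\in\mathbb{R}^m}P[(f-P(f)-\beta^Th)^2]$, let $\epsilon=f-P(f)-\beta^\star(f)^Th$, $S^\star=\operatorname{supp}(\beta^\star(f))=\{j:\beta^\star_j(f)\neq0\}$, assumed nonempty, and $\ell^\star=|S^\star|$. Assume: (i) $\epsilon\in\mathcal{G}(\tau^2)$ for some $\tau>0$; (ii) $U_h:=\max_j\sup_{x\in\mathcal{X}}|h_j(x)|<\infty$; (iii) (restricted eigenvalue condition) there exists $\gamma^\star>0$ such that $u^TGu\ge\gamma^\star\|u\|_2^2$ for all $u\in\mathcal{C}(S^\star;3)$, where $G=P(hh^T)$. Let $\xi=\ell^\star U_h^2/\gamma^\star$ and let $X_1,\ldots,X_n$ be i.i.d. $P$. Then for all $\delta\in(0,1)$, all integers $n$ and all $\lambda$ with $$n\ge\max\bigl(8\xi^2\log(8m^2/\delta),\;128\xi\log(8m/\delta)\bigr),\qquad \lambda\ge7U_h\sqrt{\log(8m/\delta)}\,\tau/\sqrt n,$$ with probability at least $1-\delta$, $$|\hat\alpha_n^{\mathrm{lasso}}(f)-P(f)|\le\sqrt{2\log(8/\delta)}\frac{\tau}{\sqrt n}+68\lambda\ell^\star\sqrt{\log(8m/\delta)}\frac{U_h/\gamma^\star}{\sqrt n},$$ and, when $\lambda$ equals the lower bound $7U_h\sqrt{\log(8m/\delta)}\tau/\sqrt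 n$, on the same event $$|\hat\alpha_n^{\mathrm{lasso}}(f)-P(f)|\le\sqrt{2\log(8/\delta)}\frac{\tau}{\sqrt n}+476\,\ell^\star\log(8m/\delta)(U_h^2/\gamma^\star)\frac{\tau}{n}.$$
   Context: $P(g)=\int g\,dP$, $P_n(g)=n^{-1}\sum_{i=1}^ng(X_i)$. A centered random variable $Y$ is in $\mathcal{G}(\tau^2)$ if $\log\mathbb{E}[e^{\lambda Y}]\le\lambda^2\tau^2/2$ for all real $\lambda$; for a function $\epsilon$ this means $\int e^{\lambda\epsilon}dP\le e^{\lambda^2\tau^2/2}$ for all $\lambda$. For $S\subset\{1,\ldots,m\}$, $\overline S$ its complement, $u_S=(u_k)_{k\in S}$, and $\mathcal{C}(S;\alpha)=\{u\in\mathbb{R}^m:\|u_{\overline S}\|_1\le\alpha\|u_S\|_1\}$. With $f^{(n)}=(f(X_i))_{i\le n}$, $H=(h_j(X_i))_{i,j}$, $f_c^{(n)}=f^{(n)}-\mathbb{1}_n(\mathbb{1}_n^Tf^{(n)})/n$, $H_c=H-\mathbb{1}_n(\mathbb{1}_n^TH)/n$, the LASSO estimator with parameter $\lambda>0$ is $\hat\alpha_n^{\mathrm{lasso}}(f)=P_n[f-\hat\beta_n^{\mathrm{lasso}}(f)^Th]$ where $\hat\beta_n^{\mathrm{lasso}}(f)\in\arg\min_{\beta\in\mathbb{R}^m}\frac{1}{2n}\|f_c^{(n)}-H_c\beta\|_2^2+\lambda\|\beta\|_1$. *)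

(* Defs.v *)
From HB Require Import structures.
From mathcomp Require Import all_boot all_order all_algebra.
From mathcomp Require Import all_classical all_reals all_analysis.
Set Implicit Arguments. Unset Strict Implicit. Unset Printing Implicit Defensive.
Import Order.TTheory GRing.Theory Num.Theory.
Import numFieldNormedType.Exports.
Local Open Scope classical_set_scope.
Local Open Scope ring_scope.

Definition PE {d} {T : measurableType d} {R : realType}
  (P : probability T R) (g : T -> R) : R := \int[P]_x g x.

Definition subgaussian {d} {T : measurableType d} {R : realType}
  (P : probability T R) (tau2 : R) (eps : T -> R) : Prop :=
  forall lam : R,
    (\int[P]_x (expR (lam * eps x))%:E <= (expR (lam ^+ 2 * tau2 / 2))%:E)%E.

Definition cone {R : realType} {m : nat} (S : {set 'I_m}) (alpha : R)
  (u : 'I_m -> R) : Prop :=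
  \sum_(j in ~: S) `|u j| <= alpha * \sum_(j in S) `|u j|.

Definition supp {R : realType} {m : nat} (beta : 'I_m -> R) : {set 'I_m} :=
  [set j | beta j != 0].

Definition Uh {T : Type} {R : realType} {m : nat} (h : 'I_m -> T -> R) : R :=
  sup (range (fun p : 'I_m * T => `|h p.1 p.2|)).

Definition h_bounded {T : Type} {R : realType} {m : nat} (h : 'I_m -> T -> R)
  : Prop := has_ubound (range (fun p : 'I_m * T => `|h p.1 p.2|)).

Definition Gram {d} {T : measurableType d} {R : realType} (P : probability T R)
  {m : nat} (h : 'I_m -> T -> R) (j k : 'I_m) : R := PE P (fun x => h j x * h k x).

Definition iid_sample {d d'} {T : measurableType d} {Omega : measurableType d'}
  {R : realType} (Q : probability Omega R) (P : probability T R) (n : nat)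
  (X : 'I_n -> Omega -> T) : Prop :=
  [/\ forall i, measurable_fun setT (X i),
      forall i (A : set T), measurable A -> Q (X i @^-1` A) = P A &
      forall A : 'I_n -> set T, (forall i, measurable (A i)) ->
        Q (\bigcap_(i in [set: 'I_n]) (X i @^-1` A i)) =
        (\prod_(i < n) Q (X i @^-1` A i))%E ].

Definition Pn {T : Type} {R : realType} {n : nat} (x : 'I_n -> T) (g : T -> R) : R :=
  n%:R^-1 * \sum_(i < n) g (x i).

Definition lasso_obj {T : Type} {R : realType} {n m : nat} (x : 'I_n -> T)
  (f : T -> R) (h : 'I_m -> T -> R) (lam : R) (beta : 'I_m -> R) : R :=
  (2 * n%:R)^-1 * \sum_(i < n)
     ((f (x i) - Pn x f) - \sum_(j < m) (h j (x i) - Pn x (h j)) * beta j) ^+ 2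
  + lam * \sum_(j < m) `|beta j|.

Definition lasso_minimizer {T : Type} {R : realType} {n m : nat} (x : 'I_n -> T)
  (f : T -> R) (h : 'I_m -> T -> R) (lam : R) (beta : 'I_m -> R) : Prop :=
  forall b : 'I_m -> R, lasso_obj x f h lam beta <= lasso_obj x f h lam b.

Definition alpha_lasso {T : Type} {R : realType} {n m : nat} (x : 'I_n -> T)
  (f : T -> R) (h : 'I_m -> T -> R) (beta : 'I_m -> R) : R :=
  Pn x (fun t => f t - \sum_(j < m) beta j * h j t).

(* Main.v *)
(* Let u = bhat - beta*, r = |u|_1 and y = u^T h / (r U), so that |y| <= 1.  The restricted
   eigenvalue condition is only needed in the direction u, and P(y^2) has to be bounded above by
   P_n(y^2).  A bound on the entries of the empirical Gram matrix loses too much for the stated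
   sample size; instead write y as a convex combination of the signed control variates +-h_j/U and
   sample M of them (Maurey).  With independent signs e_1, ..., e_M of conditional means
   Y_1, ..., Y_M at the sampled functions, the mean of
   1 - s * (average of e_i e_j over i <> j) is a positive function of x, and Markov's inequality
   for the product of its values at X_1, ..., X_n, with a union bound over the (2m)^M tuples,
   bounds the sum of its logarithms.  Averaging over the tuple and the signs, where Jensen moves
   the logarithm inside, turns that into s P(y^2) <= c + g P_n(y^2) + b/n.

   The LASSO three-point inequality, P_n(epsilon^2) <= 5/4 tau^2 (a Gaussian mixture bound) and the
   deviations of P_n(h_j), P_n(h_j epsilon) then exclude r > 48 lambda l / gamma, after a choice of
   M and s according to the size of n / (xi log(8m/delta)).  Finally
   alpha_lasso - P(f) = P_n(epsilon) - P_n(u^T h), and 48 sqrt 2 <= 68. *)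
Require Import Defs.
From HB Require Import structures.
From mathcomp Require Import all_boot all_order all_algebra.
From mathcomp Require Import all_classical all_reals all_analysis.
From mathcomp Require Import measurable_realfun ring lra.
Import Order.TTheory GRing.Theory Num.Theory.
Import numFieldNormedType.Exports.
Local Open Scope classical_set_scope.
Local Open Scope ring_scope.

Set Implicit Arguments. Unset Strict Implicit.

(** * Real inequalities *)

(** When all signs have mean y, the average of e_i e_j over i <> j is unbiased for y^2, and it is
    never below -1/(M-1). So the kernel stays away from 0 for s <= 7/10 and its logarithm is
    controlled by an explicit cubic. Two costs compete: an additive error of order (s/M)^2 from the
    noise of the signs, and M log(2m)/n from the union bound; hence a choice of M by range. The
    weights of the convex combination depend on the sample, which is why all tuples must be
    controlled before they are chosen. The contradiction is read after multiplying by xi. With a =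
    |u_S|_1 / |u|_1, the restricted eigenvalue condition gives xi P(y^2) >= a^2, while for r > 48
    lambda l / gamma the LASSO inequality keeps xi P_n(y^2) below (2a - 0.689)/48 + 2/N: dividing by
    r makes the empirical moment small. In this comparison the sample size only enters through N =
    n/(xi log(8m/delta)) and V = max(N, 16 xi). The number 48 is the largest integer whose product
    with sqrt 2 is at most 68, so the other estimates must be sharp enough to leave it. *)

Lemma one_sub_expR_ge1_end (R : realType) :
  1 <= (1 - 7/10) * expR (7/10 + 55/100 * (7/10) ^+ 2 + 3/4 * (7/10) ^+ 3) :> R.
Proof.
(* The exponent is 4907/4000. Its 64th part is bounded by the tangent of the exponential and squared
   six times, rounding down, up to 3.34 > 10/3. *)
rewrite (_ : 7 / 10 + _ + _ = 64%:R * (4907/(4000 * 64))); last by field.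
rewrite expRM_natl; set e := expR _.
have sq (u v : R) k : 0 <= v -> v <= u ^+ k -> v ^+ 2 <= u ^+ (k * 2).
  by move=> v0 vu; rewrite exprM lerXn2r// nnegrE (le_trans v0).
have e0 : 1 + 191/(100 * 100) <= e ^+ 1.
  by rewrite expr1; apply: le_trans (expR_ge1Dx _); clear; lra.
have e1 : 1 + 385/(100 * 100) <= e ^+ 2.
  by apply: le_trans (sq _ _ _ _ e0); clear; lra.
have e2 : 1 + 784/(100 * 100) <= e ^+ 4.
  by apply: le_trans (sq _ _ _ _ e1); clear; lra.
have e3 : 1 + 1629/(100 * 100) <= e ^+ 8.
  by apply: le_trans (sq _ _ _ _ e2); clear; lra.
have e4 : 1 + 3523/(100 * 100) <= e ^+ 16.
  by apply: le_trans (sq _ _ _ _ e3); clear; lra.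
have e5 : 1 + 8287/(100 * 100) <= e ^+ 32.
  by apply: le_trans (sq _ _ _ _ e4); clear; lra.
have e6 : 334/100 <= e ^+ 64.
  by apply: le_trans (sq _ _ _ _ e5); clear; lra.
by clear -e6; lra.
Qed.

Section real_bounds.
Context {R : realType}.
Implicit Types x y z U : R.

Lemma is_derive_ge0_le (f df : R -> R) (a b : R) :
  (forall x, is_derive x 1 f (df x)) -> (forall x, a <= x <= b -> 0 <= df x) ->
  a <= b -> f a <= f b.
Proof.
move=> fdf df0 ab.
have cf x : {for x, continuous f}.
  by apply/differentiable_continuous/derivable1_diffP; apply: ex_derive.
have [c cab E] : exists2 c, c \in `[a, b]%R & f b - f a = df c * (b - a).
  apply: MVT_segment => //.
  by apply: continuous_subspaceT.
rewrite -subr_ge0 E mulr_ge0 ?subr_ge0// df0//.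
Qed.

(** For x >= 0 the function -2 cosh(x) exp(-x^2/2) is nondecreasing: its derivative is exp(-x^2/2)
    times [S] = 2 (x cosh x - sinh x), and [S] vanishes at 0 and has derivative 2 x sinh x. *)
Lemma cosh_le_expR_sqr x : expR x + expR (- x) <= 2 * expR (x ^+ 2 / 2).
Proof.
wlog x0 : x / 0 <= x.
  move=> h; have [/h //|x0] := leP 0 x.
  by rewrite addrC -sqrrN -{2}[x]opprK h// oppr_ge0 ltW.
pose S : R -> R := id * (expR + (expR \o -%R)) - (expR - (expR \o -%R)).
have dS y : is_derive y 1 S (y * (expR y - expR (- y))).
  rewrite /S; apply: is_derive_eq.
  rewrite /GRing.scale/= !fctE/=.
  ring.
have S0 y : 0 <= y -> 0 <= S y.
  move=> y0; have -> : 0 = S 0.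
    by rewrite /S !fctE/= oppr0 mul0r subrr subr0.
  apply: (is_derive_ge0_le dS) => // z /andP[z0 _].
  by rewrite mulr_ge0// subr_ge0 ler_expR; lra.
pose h : R -> R := (expR \o (fun z => - (z ^+ 2 / 2))) * (- (expR + (expR \o -%R))).
have dh y : is_derive y 1 h (expR (- (y ^+ 2 / 2)) * S y).
  have dq : is_derive y 1 (fun z : R => - (z ^+ 2 / 2)) (- y).
    have -> : (fun z : R => - (z ^+ 2 / 2)) = (- 2^-1) *: (id ^+ 2 : R -> R).
      by apply/funext => z; rewrite !fctE /GRing.scale/=; field.
    by apply: is_derive_eq; rewrite /GRing.scale/=; field.
  rewrite /h; apply: is_derive_eq.
  rewrite /S /GRing.scale/= !fctE/=; ring.
have : h 0 <= h x.
  by apply: (is_derive_ge0_le dh) => // z /andP[z0 _]; rewrite mulr_ge0 ?expR_ge0 ?S0.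
rewrite /h !fctE/= expr0n/= mul0r !oppr0 expR0 expRN mul1r mulrN lerN2.
by rewrite mulrC ler_pdivrMr ?expR_gt0.
Qed.

(** Equivalently -ln(1 - z) is at most the cubic; its coefficients exceed the Taylor values 1/2 and
    1/3 so as to reach 7/10. The interval contains all values of [s * pair_mean], as (7/10)/11 <
    16/250. The derivative of [h] is a positive factor times z [br z] with [br] concave, so [h]
    falls to 1 at 0, rises, then may fall until 7/10: only 0 and the right end matter. *)
Lemma one_sub_expR_ge1 (z : R) : - (16/250) <= z -> z <= 7/10 ->
  1 <= (1 - z) * expR (z + 55/100 * z ^+ 2 + 3/4 * z ^+ 3).
Proof.
move=> z1 z2.
pose p : R -> R := fun z => z + 55/100 * z ^+ 2 + 3/4 * z ^+ 3.
pose h : R -> R := (cst 1 - id) * (expR \o p).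
pose br : R -> R := fun z => 1/10 + 23/20 * z - 9/4 * z ^+ 2.
have dh y : is_derive y 1 h (expR (p y) * (y * br y)).
  have dp : is_derive y 1 p (1 + 11/10 * y + 9/4 * y ^+ 2).
    have -> : p = id + (55/100) *: (id ^+ 2 : R -> R) + (3/4) *: (id ^+ 3 : R -> R).
      by apply/funext => t; rewrite /p !fctE /GRing.scale/=.
    have dX k : is_derive y 1 (id ^+ k : R -> R) ((k%:R * y ^+ k.-1) *: 1).
      exact: is_deriveX.
    apply: is_derive_eq (is_deriveD (is_deriveD (is_derive_id y 1)
      (is_deriveZ (55/100) (dX 2))) (is_deriveZ (3/4) (dX 3))) _.
    by rewrite /GRing.scale/=; field.
  rewrite /h; apply: is_derive_eq.
  rewrite /br /GRing.scale/= !fctE/=.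
  by field.
have h0 : h 0 = 1 by rewrite /h /p !fctE/= !expr0n/= !mulr0 !addr0 expR0; ring.
suff : 1 <= h z by [].
have [zle|zgt] := leP z 0.
  rewrite -h0 -lerN2.
  have dNh y : is_derive y 1 (- h) (- (expR (p y) * (y * br y))).
    exact: is_deriveN.
  apply: (is_derive_ge0_le dNh) => // y /andP[y1 y2].
  rewrite -mulrN mulr_ge0 ?expR_ge0// -mulNr mulr_ge0 ?oppr_ge0//.
  have := @mulr_ge0 _ (y + 16/250) (- y); rewrite /br; lra.
have [brz|brz] := leP 0 (br z).
  rewrite -h0; apply: (is_derive_ge0_le dh); last exact: ltW.
  move=> y /andP[y0 yz]; rewrite mulr_ge0 ?expR_ge0// mulr_ge0//.
  (* [br] takes the same value 1/10 at 0 and at 23/45; beyond 23/45 it decreases, so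
     [br y >= br z]. *)
  move: brz; rewrite /br => brz; have [y1|y1] := leP y (23/45).
    have : 0 <= y * (23/20 - 9/4 * y) by rewrite mulr_ge0//; lra.
    lra.
  have : 0 <= (z - y) * (9/4 * (z + y) - 23/20) by rewrite mulr_ge0//; lra.
  lra.
have : h z >= h (7/10).
  have dNh y : is_derive y 1 (- h) (- (expR (p y) * (y * br y))).
    exact: is_deriveN.
  rewrite -lerN2.
  apply: (is_derive_ge0_le dNh) => // y /andP[y1 y2].
  rewrite -mulrN mulr_ge0 ?expR_ge0// -mulrN mulr_ge0 ?oppr_ge0//; first lra.
  move: brz; rewrite /br => brz.
  have z3 : 23/45 < z.
    rewrite ltNge; apply/negP => z3.
    have : 0 <= z * (23/20 - 9/4 * z) by rewrite mulr_ge0//; lra.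
    lra.
  have : 0 <= (y - z) * (9/4 * (y + z) - 23/20) by rewrite mulr_ge0//; lra.
  lra.
apply: le_trans; rewrite /h /p !fctE/=; exact: one_sub_expR_ge1_end.
Qed.

Lemma expR_convex (t a b : R) : 0 <= t <= 1 ->
  expR (t * a + (1 - t) * b) <= t * expR a + (1 - t) * expR b.
Proof.
move=> /andP[t0 t1]; set c := t * a + (1 - t) * b.
have tangent y : expR c * (1 + (y - c)) <= expR y.
  have -> : expR y = expR c * expR (y - c) by rewrite -expRD addrC subrK.
  by rewrite ler_wpM2l ?expR_ge0// expR_ge1Dx.
have -> : expR c = t * (expR c * (1 + (a - c))) + (1 - t) * (expR c * (1 + (b - c))).
  by rewrite /c; ring.
by rewrite lerD// ler_wpM2l// subr_ge0.
Qed.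

(** The right side is the chord of the exponential over [-U, U]. It is affine in [x], so for a
    centered variable only its constant term cosh(l U) survives integration. *)
Lemma expR_convex_bound (l U x : R) : 0 < U -> `|x| <= U ->
  expR (l * x) <= (expR (l * U) + expR (- (l * U))) / 2
                  + x * ((expR (l * U) - expR (- (l * U))) / (2 * U)).
Proof.
move=> U0 xU.
have x1 : x <= U by rewrite (le_trans (ler_norm _)).
have x2 : - U <= x by rewrite lerNl (le_trans _ xU)// -normrN ler_norm.
have t01 : 0 <= (U + x) / (2 * U) <= 1.
  rewrite divr_ge0 ?ler_pdivrMr /=; lra.
have := expR_convex (l * U) (- (l * U)) t01.
rewrite (_ : _ + _ = l * x); last by field; lra.
by move=> /le_trans; apply; rewrite le_eqVlt; apply/orP; left; apply/eqP; field; lra.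
Qed.

(** Monotonicity of cosh in the modulus gives [expR y + expR (- y) <= expR a + expR (- a)], and
    [expR (- y) >= 1 - y]. The linear term [y] is kept because it will integrate to 0. *)
Lemma expR_le_cosh (y a : R) : `|y| <= `|a| ->
  expR y <= y + expR a + expR (- a) - 1.
Proof.
wlog a0 : a / 0 <= a.
  move=> h; have [a0|a0] := leP 0 a; first exact: h.
  rewrite -(normrN a) => ya.
  have := h (- a) _ ya; rewrite oppr_ge0 opprK => /(_ (ltW a0)); lra.
rewrite (ger0_norm a0) ler_norml => ya.
have /andP[y1 y2] := ya.
have e1 := expR_ge1Dx (- y).
have : 0 <= (expR a - expR y) * (1 - expR (- a - y)).
  rewrite mulr_ge0// subr_ge0 ?ler_expR//.
  by rewrite expR_le1; lra.
rewrite mulrBr mulr1 mulrBl -!expRD.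
rewrite (_ : a + (- a - y) = - y); last by ring.
rewrite (_ : y + (- a - y) = - a); last by ring.
lra.
Qed.
End real_bounds.

(** * The sign kernel *)

Section sign_vectors.
Context {R : realType}.
Implicit Types (Y : seq R) (g : R -> R) (t y : R) (M : nat).

(* Expectation of [g (t + e_1 + ... + e_k)] over independent signs [e_i] whose means are the
   entries of the list. *)
Fixpoint sgnE Y g t : R :=
  if Y is y :: Y' then (1 + y) / 2 * sgnE Y' g (t + 1) + (1 - y) / 2 * sgnE Y' g (t - 1)
  else g t.

Definition unit_bounded Y := all (fun y => `|y| <= 1) Y.

Lemma unit_bounded_cons y Y : unit_bounded (y :: Y) ->
  [/\ 0 <= (1 + y) / 2, 0 <= (1 - y) / 2 & unit_bounded Y].
Proof.
by move=> /andP[+ bY]; rewrite ler_norml => /andP[y1 y2]; split => //; lra.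
Qed.

Lemma sgnE_cst Y (c t : R) : sgnE Y (cst c) t = c.
Proof. by elim: Y t => //= y Y IH t; rewrite !IH; field. Qed.

Lemma sgnE_lin Y g1 g2 (a b t : R) :
  sgnE Y (fun u => a * g1 u + b * g2 u) t = a * sgnE Y g1 t + b * sgnE Y g2 t.
Proof. by elim: Y t => //= y Y IH t; rewrite !IH; ring. Qed.

(** A walk of [size Y] unit steps from [t] stays in [-N, N]. This is why the lemmas below ask
    conditions on [g] only there, where the kernel is positive. *)
Let step (N t : R) k : `|t| + k.+1%:R <= N ->
  `|t + 1| + k%:R <= N /\ `|t - 1| + k%:R <= N.
Proof.
rewrite -natr1 => h; split.
  by have := ler_normD t 1; rewrite normr1; lra.
by have := ler_normB t 1; rewrite normr1; lra.
Qed.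

Lemma sgnE_le Y g1 g2 (N t : R) : unit_bounded Y -> `|t| + (size Y)%:R <= N ->
  (forall u, `|u| <= N -> g1 u <= g2 u) -> sgnE Y g1 t <= sgnE Y g2 t.
Proof.
move=> + + g12; elim: Y t => [|y Y IH] t /=; first by move=> _; rewrite addr0; exact: g12.
move=> /unit_bounded_cons[p q bY] /step[h1 h2].
by rewrite lerD// ler_wpM2l// IH.
Qed.

Lemma sgnE_gt0 Y g (N t : R) : unit_bounded Y -> `|t| + (size Y)%:R <= N ->
  (forall u, `|u| <= N -> 0 < g u) -> 0 < sgnE Y g t.
Proof.
move=> + + g0; elim: Y t => [|y Y IH] t /=; first by move=> _; rewrite addr0; exact: g0.
move=> /unit_bounded_cons[p q bY] /step[h1 h2].
have A := IH _ bY h1; have B := IH _ bY h2.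
(* One of the two weights may vanish, but not both. *)
have [p0|p0] := ltP 0 ((1 + y) / 2).
  by apply: ltr_pwDl; [rewrite mulr_gt0|rewrite mulr_ge0// ltW].
by apply: ltr_wpDl; [rewrite mulr_ge0// ltW|rewrite mulr_gt0//; lra].
Qed.

Lemma sgnE_ln_le Y g (N t : R) : unit_bounded Y -> `|t| + (size Y)%:R <= N ->
  (forall u, `|u| <= N -> 0 < g u) -> sgnE Y (@ln R \o g) t <= ln (sgnE Y g t).
Proof.
move=> + + g0; elim: Y t => [|y Y IH] t //=.
move=> /unit_bounded_cons[p q bY] /step[h1 h2].
have A := sgnE_gt0 bY h1 g0; have B := sgnE_gt0 bY h2 g0.
have IA := IH _ bY h1; have IB := IH _ bY h2.
apply: (@le_trans _ _ ((1 + y) / 2 * ln (sgnE Y g (t + 1)) +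
                       (1 - y) / 2 * ln (sgnE Y g (t - 1)))).
  by rewrite lerD// ler_wpM2l.
have E : (1 - y) / 2 = 1 - (1 + y) / 2 by field.
have p1 : 0 <= (1 + y) / 2 <= 1 by lra.
have := expR_convex (ln (sgnE Y g (t + 1))) (ln (sgnE Y g (t - 1))) p1.
rewrite !lnK ?posrE// E => /(le_trans _) h.
have pos : 0 < (1 + y) / 2 * sgnE Y g (t + 1) + (1 - (1 + y) / 2) * sgnE Y g (t - 1).
  have [p0|p0] := ltP 0 ((1 + y) / 2).
    by apply: ltr_pwDl; [rewrite mulr_gt0|apply: mulr_ge0; [lra|exact: ltW]].
  by apply: ltr_wpDl; [rewrite mulr_ge0// ltW|rewrite mulr_gt0//; lra].
by rewrite -[leLHS]expRK ler_ln ?posrE ?expR_gt0// h.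
Qed.

Lemma sgnE_ext Y g1 g2 t : g1 =1 g2 -> sgnE Y g1 t = sgnE Y g2 t.
Proof. by move=> e; elim: Y t => //= y Y IH t; rewrite !IH. Qed.

(** Even moments suffice because [pair_mean] depends on [t ^+ 2], and degree 6 covers its cube. The
    arbitrary start [t] makes the induction over the signs close; the coefficients are the moments
    of a sum of [M] signs of mean [y]. *)
Lemma sgnE_sqr M y t :
  sgnE (nseq M y) (fun u => u ^+ 2) t =
  let m := M%:R in t ^+ 2 + 2 * t * (m * y) + (m + (m ^+ 2 - m) * y ^+ 2).
Proof.
elim: M t => [|M IH] t /=; first by rewrite !mulr0n; ring.
by rewrite !IH -natr1 /=; field.
Qed.

Lemma sgnE_pow4 M y t :
  sgnE (nseq M y) (fun u => u ^+ 4) t =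
  let m := M%:R in
  t ^+ 4 + 4 * t ^+ 3 * (m * y) + 6 * t ^+ 2 * (m + (m ^+ 2 - m) * y ^+ 2)
  + 4 * t * ((3 * m ^+ 2 - 2 * m) * y + (2 * m - 3 * m ^+ 2 + m ^+ 3) * y ^+ 3)
  + ((3 * m ^+ 2 - 2 * m) + (8 * m - 14 * m ^+ 2 + 6 * m ^+ 3) * y ^+ 2
     + (m ^+ 4 - 6 * m ^+ 3 + 11 * m ^+ 2 - 6 * m) * y ^+ 4).
Proof.
elim: M t => [|M IH] t /=; first by rewrite !mulr0n; ring.
by rewrite !IH -natr1 /=; field.
Qed.

Lemma sgnE_pow6 M y t :
  sgnE (nseq M y) (fun u => u ^+ 6) t =
  let m := M%:R in
  t ^+ 6 + 6 * t ^+ 5 * (m * y) + 15 * t ^+ 4 * (m + (m ^+ 2 - m) * y ^+ 2)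
  + 20 * t ^+ 3 * ((3 * m ^+ 2 - 2 * m) * y + (2 * m - 3 * m ^+ 2 + m ^+ 3) * y ^+ 3)
  + 15 * t ^+ 2 * ((3 * m ^+ 2 - 2 * m) + (8 * m - 14 * m ^+ 2 + 6 * m ^+ 3) * y ^+ 2
     + (m ^+ 4 - 6 * m ^+ 3 + 11 * m ^+ 2 - 6 * m) * y ^+ 4)
  + 6 * t * ((16 * m - 30 * m ^+ 2 + 15 * m ^+ 3) * y
     + (10 * m ^+ 4 - 50 * m ^+ 3 + 80 * m ^+ 2 - 40 * m) * y ^+ 3
     + (24 * m - 50 * m ^+ 2 + 35 * m ^+ 3 - 10 * m ^+ 4 + m ^+ 5) * y ^+ 5)
  + ((16 * m - 30 * m ^+ 2 + 15 * m ^+ 3)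
     + (45 * m ^+ 4 - 195 * m ^+ 3 + 286 * m ^+ 2 - 136 * m) * y ^+ 2
     + (240 * m - 530 * m ^+ 2 + 405 * m ^+ 3 - 130 * m ^+ 4 + 15 * m ^+ 5) * y ^+ 4
     + (m ^+ 6 - 15 * m ^+ 5 + 85 * m ^+ 4 - 225 * m ^+ 3 + 274 * m ^+ 2 - 120 * m) * y ^+ 6).
Proof.
elim: M t => [|M IH] t /=; first by rewrite !mulr0n; ring.
by rewrite !IH -natr1 /=; field.
Qed.
End sign_vectors.

Section kernel.
Context {R : realType}.
Implicit Types (s y t : R) (M : nat).

(* If [t] is a sum of [M] signs, the average of the products of two distinct ones. *)
Definition pair_mean M (t : R) : R := (t ^+ 2 - M%:R) / (M%:R ^+ 2 - M%:R).

Definition kern M s (t : R) : R := 1 - s * pair_mean M t.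

(* Second and third moments of [pair_mean] under fair signs. *)
Definition kern_moment2 M : R := 2 / (M%:R ^+ 2 - M%:R).
Definition kern_moment3 M : R := 8 * (M%:R - 2) / (M%:R ^+ 2 - M%:R) ^+ 2.
(** The mean of the cubic of [one_sub_expR_ge1] at [z = s * pair_mean] for fair signs, whose linear
    term averages to 0. *)
Definition kern_offset M s : R := 55/100 * s ^+ 2 * kern_moment2 M + 3/4 * s ^+ 3 * kern_moment3 M.
(** The same cubic at [z = s], its value when all signs agree. *)
Definition kern_slope s : R := s + 55/100 * s ^+ 2 + 3/4 * s ^+ 3.

(** The minimum -1/(M-1) is at [t = 0], the maximum 1 at the two ends. *)
Lemma pair_mean_bounds M t : (12 <= M)%N -> `|t| <= M%:R ->
  - (1/11) <= pair_mean M t <= 1.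
Proof.
move=> M12; have m12 : 12 <= M%:R :> R by rewrite (ler_nat _ 12).
rewrite ler_norml => /andP[t1 t2]; rewrite /pair_mean; set m : R := M%:R in m12 t1 t2 *.
have D0 : 0 < m ^+ 2 - m by rewrite expr2; nra.
have t2m : t ^+ 2 <= m ^+ 2.
  have : 0 <= (m - t) * (m + t) by rewrite mulr_ge0//; lra.
  lra.
rewrite ler_pdivlMr// ler_pdivrMr//; apply/andP; split; last by lra.
have := sqr_ge0 t; have : 0 <= (m - 12) * m by rewrite mulr_ge0//; lra.
lra.
Qed.

Lemma kern_ge M s t : (12 <= M)%N -> 0 < s <= 7/10 -> `|t| <= M%:R ->
  3/10 <= kern M s t.
Proof.
move=> M12 /andP[s0 s1] /(pair_mean_bounds M12)/andP[_ u1].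
have : s * pair_mean M t <= s * 1 by rewrite ler_wpM2l// ltW.
rewrite /kern; lra.
Qed.

Lemma kern_gt0 M s t : (12 <= M)%N -> 0 < s <= 7/10 -> `|t| <= M%:R -> 0 < kern M s t.
Proof. by move=> M12 s01 /(kern_ge M12 s01); apply: lt_le_trans; lra. Qed.

Lemma ln_kern_ge M s t : (12 <= M)%N -> 0 < s <= 7/10 -> `|t| <= M%:R ->
  let z := s * pair_mean M t in
  - (z + 55/100 * z ^+ 2 + 3/4 * z ^+ 3) <= ln (kern M s t).
Proof.
move=> M12 s01 tM /=; set z := s * pair_mean M t; have k0 := kern_gt0 M12 s01 tM.
have /andP[s0 s1] := s01; have /andP[u0 u1] := pair_mean_bounds M12 tM.
have z1 : z <= 7/10.
  have : s * pair_mean M t <= s * 1 by rewrite ler_wpM2l// ltW.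
  rewrite -/z; lra.
have z0 : - (16/250) <= z.
  have : s * (- (1/11)) <= s * pair_mean M t by rewrite ler_wpM2l// ltW.
  rewrite -/z; lra.
have := one_sub_expR_ge1 z0 z1; set q := _ + _ + _.
move=> h; rewrite -[leLHS]expRK ler_ln ?posrE ?expR_gt0//.
by rewrite expRN -[leLHS]mul1r ler_pdivrMr ?expR_gt0.
Qed.

Lemma sgnE_kern M s y : (12 <= M)%N -> sgnE (nseq M y) (kern M s) 0 = 1 - s * y ^+ 2.
Proof.
move=> M12; have m12 : 12 <= M%:R :> R by rewrite (ler_nat _ 12).
have D0 : M%:R ^+ 2 - M%:R != 0 :> R by rewrite gt_eqF//; nra.
rewrite (@sgnE_ext _ _ _ (fun u => (1 + s * M%:R / (M%:R ^+ 2 - M%:R)) * (cst 1) u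
  + (- s / (M%:R ^+ 2 - M%:R)) * (u ^+ 2))); last first.
  by move=> u; rewrite /kern /pair_mean /=; field.
by rewrite sgnE_lin sgnE_cst sgnE_sqr /=; field.
Qed.

(** The mean of the cubic is a polynomial in [y ^+ 2] with constant term [kern_offset]. In its
    quadratic and cubic parts the other coefficients sum to 1 minus the fair second, respectively
    third, moment, and those of [y ^+ 4] and [y ^+ 6] are nonnegative; replacing these powers by
    [y ^+ 2] therefore costs at most [kern_slope]. *)
Lemma sgnE_ln_kern M s y : (12 <= M)%N -> 0 < s <= 7/10 -> `|y| <= 1 ->
  - (kern_offset M s + kern_slope s * y ^+ 2) <= sgnE (nseq M y) (@ln R \o kern M s) 0.
Proof.
move=> M12 s01 y1; have m12 : 12 <= M%:R :> R by rewrite (ler_nat _ 12).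
have /andP[s0 s1] := s01.
set m : R := M%:R; set D := m ^+ 2 - m.
have D0 : 0 < D by rewrite /D; nra.
have [m2 m3 m4 m5 m10] : [/\ 0 <= m - 2, 0 <= m - 3, 0 <= m - 4, 0 <= m - 5 & 0 <= 3 * m - 10].
  by split; rewrite /m; lra.
have D0' : D != 0 by rewrite gt_eqF.
have bY : unit_bounded (nseq M y) by rewrite /unit_bounded all_nseq y1 orbT.
pose z t := s * pair_mean M t.
apply: (@le_trans _ _ (sgnE (nseq M y)
    (fun t => - (z t + 55/100 * z t ^+ 2 + 3/4 * z t ^+ 3)) 0)); last first.
  apply: (@sgnE_le _ _ _ _ m) => //; first by rewrite normr0 add0r size_nseq.
  by move=> u um; exact: ln_kern_ge.
(* Coefficients of the negated cubic in powers of the sum of signs [u], with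
   [z = s * (u ^+ 2 - m) / D]. *)
pose k0 := s * m / D - 55/100 * s ^+ 2 * m ^+ 2 / D ^+ 2 + 3/4 * s ^+ 3 * m ^+ 3 / D ^+ 3.
pose k2 := - (s / D) + 55/100 * s ^+ 2 * 2 * m / D ^+ 2 - 3/4 * s ^+ 3 * 3 * m ^+ 2 / D ^+ 3.
pose k4 := - (55/100 * s ^+ 2 / D ^+ 2) + 3/4 * s ^+ 3 * 3 * m / D ^+ 3.
pose k6 := - (3/4 * s ^+ 3 / D ^+ 3).
rewrite (@sgnE_ext _ _ _ (fun u => 1 * (k0 * (cst 1) u + k2 * u ^+ 2) +
   1 * (k4 * u ^+ 4 + k6 * u ^+ 6))); last first.
  by move=> u; rewrite /z /pair_mean -/m -/D /k0 /k2 /k4 /k6 /=; field.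
rewrite !sgnE_lin sgnE_cst sgnE_sqr sgnE_pow4 sgnE_pow6 -/m /=.
set A := (X in _ <= X).
pose a2 := 4 * (m - 2) / D; pose a4 := (m - 2) * (m - 3) / D.
pose b2 := 2 * (15 * m ^+ 2 - 63 * m + 68) / D ^+ 2.
pose b4 := 4 * ((m - 2) * (m - 3) * (3 * m - 10)) / D ^+ 2.
pose b6 := (m - 2) * (m - 3) * (m - 4) * (m - 5) / D ^+ 2.
have AE : A = - (kern_offset M s + s * y ^+ 2 + 55/100 * s ^+ 2 * (a2 * y ^+ 2 + a4 * y ^+ 4)
   + 3/4 * s ^+ 3 * (b2 * y ^+ 2 + b4 * y ^+ 4 + b6 * y ^+ 6)).
  rewrite /A /kern_offset /kern_moment2 /kern_moment3 /k0 /k2 /k4 /k6 /a2 /a4 /b2 /b4 /b6 -/m /D.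
  by field.
have y2 : 0 <= y ^+ 2 <= 1 by rewrite sqr_ge0 -real_normK ?num_real//= expr_le1.
have /andP[y20 y21] := y2.
have y42 : y ^+ 4 <= y ^+ 2 by rewrite (exprM y 2 2) -[leRHS]mulr1 ler_wpM2l.
have y62 : y ^+ 6 <= y ^+ 2.
  by rewrite (exprD y 2 4) -[leRHS]mulr1 ler_wpM2l// (le_trans y42).
have a40 : 0 <= a4 by rewrite divr_ge0 ?(ltW D0)// mulr_ge0.
have b40 : 0 <= b4.
  by rewrite divr_ge0 ?exprn_ge0 ?(ltW D0)// !mulr_ge0.
have b60 : 0 <= b6.
  by rewrite divr_ge0 ?exprn_ge0 ?(ltW D0)// !mulr_ge0.
have a1 : a2 + a4 <= 1.
  rewrite (_ : a2 + a4 = 1 - 2 / D); last by rewrite /a2 /a4 /D; field.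
  by rewrite gerBl divr_ge0// ltW.
have b1 : b2 + b4 + b6 <= 1.
  rewrite (_ : b2 + b4 + b6 = 1 - 8 * (m - 2) / D ^+ 2).
    by rewrite gerBl divr_ge0 ?exprn_ge0 ?(ltW D0)// mulr_ge0.
  by rewrite /b2 /b4 /b6 /D; field.
rewrite AE lerN2 /kern_slope.
have h1 : a2 * y ^+ 2 + a4 * y ^+ 4 <= y ^+ 2.
  apply: (@le_trans _ _ ((a2 + a4) * y ^+ 2)); last by rewrite ler_piMl.
  by rewrite mulrDl lerD2l ler_wpM2l.
have h2 : b2 * y ^+ 2 + b4 * y ^+ 4 + b6 * y ^+ 6 <= y ^+ 2.
  apply: (@le_trans _ _ ((b2 + b4 + b6) * y ^+ 2)); last by rewrite ler_piMl.
  by rewrite !mulrDl !lerD// ler_wpM2l.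
have g1 : 55/100 * s ^+ 2 * (a2 * y ^+ 2 + a4 * y ^+ 4) <= 55/100 * s ^+ 2 * y ^+ 2.
  by rewrite ler_wpM2l// mulr_ge0// ?sqr_ge0// divr_ge0.
have g2 : 3/4 * s ^+ 3 * (b2 * y ^+ 2 + b4 * y ^+ 4 + b6 * y ^+ 6) <= 3/4 * s ^+ 3 * y ^+ 2.
  by rewrite ler_wpM2l// mulr_ge0// ?exprn_ge0 ?(ltW s0)// divr_ge0.
clear -g1 g2; lra.
Qed.
End kernel.

(** * Averages over independent draws from a weighted finite family *)

Section averages.
Context {R : realType} {D : finType}.
Implicit Types (p : D -> R) (M : nat) (F : seq D -> R).

(* Expectation over [M] independent draws with weights [p]. *)
Fixpoint tuple_mean p M F : R :=
  if M is M'.+1 then \sum_d p d * tuple_mean p M' (fun l => F (d :: l)) else F [::].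

Lemma tuple_mean_lin p M F1 F2 (a b : R) :
  tuple_mean p M (fun l => a * F1 l + b * F2 l) = a * tuple_mean p M F1 + b * tuple_mean p M F2.
Proof.
elim: M F1 F2 => //= M IH F1 F2.
under eq_bigr do rewrite IH mulrDr !(mulrCA (p _)).
by rewrite big_split/= -!big_distrr.
Qed.

Lemma tuple_mean_le p M F1 F2 : (forall d, 0 <= p d) ->
  (forall l, size l = M -> F1 l <= F2 l) -> tuple_mean p M F1 <= tuple_mean p M F2.
Proof.
move=> p0; elim: M F1 F2 => [|M IH] F1 F2 h /=; first exact: h.
by apply: ler_sum => d _; rewrite ler_wpM2l// IH// => l lM; rewrite h//= lM.
Qed.

Lemma tuple_mean_cst p M (c : R) : \sum_d p d = 1 -> tuple_mean p M (cst c) = c.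
Proof.
move=> p1; elim: M => //= M IH.
by under eq_bigr do rewrite IH; rewrite -big_distrl/= p1 mul1r.
Qed.

Lemma tuple_mean_sum p M n (F : 'I_n -> seq D -> R) :
  tuple_mean p M (fun l => \sum_(i < n) F i l) = \sum_(i < n) tuple_mean p M (F i).
Proof.
elim: M F => //= M IH F.
under eq_bigr do rewrite IH big_distrr.
by rewrite exchange_big.
Qed.

(** The weights of a sign are affine in its mean, so drawing that mean at random only replaces it by
    its average. This is how the randomly drawn functions recombine into [y]. *)
Lemma tuple_mean_sgnE p M (Y : D -> R) (g : R -> R) (t : R) : \sum_d p d = 1 ->
  tuple_mean p M (fun l => sgnE (map Y l) g t) = sgnE (nseq M (\sum_d p d * Y d)) g t.
Proof.
move=> p1; elim: M t => //= M IH t.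
under eq_bigr do rewrite tuple_mean_lin !IH.
set A := sgnE _ _ _; set B := sgnE _ _ _.
transitivity (\sum_d (p d * ((A + B) / 2) + p d * Y d * ((A - B) / 2))).
  by apply: eq_bigr => d _; field.
by rewrite big_split/= -!big_distrl/= p1; field.
Qed.
End averages.

(** * Independent samples *)

Section product_expectation.
Context {R : realType} {d d' : measure_display} {T : measurableType d}
  {Omega : measurableType d'} (P : probability T R) (Q : probability Omega R).
Local Open Scope ereal_scope.

Import HBNNSimple.

(** The assumption on sets expresses independence of [X] and [g], with [C] the mean of [g]; simple
    functions and monotone convergence carry it to nonnegative [phi]. *)
Lemma integral_comp_mul (X : Omega -> T) (g : Omega -> R) (C : R)
    (phi : T -> R) :
  measurable_fun setT X -> measurable_fun setT g -> (forall w, (0 <= g w)%R) ->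
  (forall B, measurable B ->
    \int[Q]_w ((\1_B (X w) * g w)%R)%:E = P B * C%:E) ->
  measurable_fun setT phi -> (forall x, (0 <= phi x)%R) ->
  \int[Q]_w ((phi (X w) * g w)%R)%:E = (\int[P]_x (phi x)%:E) * C%:E.
Proof.
move=> mX mg g0 gC mphi phi0.
have C0 : 0 <= C%:E.
  have := gC _ measurableT; rewrite probability_setT mul1e => <-.
  by apply: integral_ge0 => w _; rewrite lee_fin mulr_ge0.
have mphiE : measurable_fun setT (fun x => (phi x)%:E) by exact/measurable_EFinP.
pose h := nnsfun_approx measurableT mphiE.
have h0 n x : (0 <= h n x)%R by [].
have cvgh x : (h n x)%:E @[n --> \oo] --> (phi x)%:E.
  by apply: (cvg_nnsfun_approx measurableT mphiE) => // t _; rewrite lee_fin.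
have ndh x (a b : nat) : (a <= b)%N -> (h a x <= h b x)%R.
  by move=> ab; exact/lefP/nd_nnsfun_approx.
have -> : \int[P]_x (phi x)%:E = lim (\int[P]_x (h n x)%:E @[n --> \oo]).
  under eq_integral => x _ do rewrite -(cvg_lim _ (cvgh x))//.
  apply: monotone_convergence => //.
  - by move=> n; apply/measurable_EFinP; exact/measurable_funP.
  - by move=> n x _ /=; rewrite lee_fin.
  - by move=> x _ a b ab; rewrite lee_fin ndh.
have mhX n : measurable_fun setT (fun w => (h n (X w) * g w)%R).
  by apply: measurable_funM => //; apply: measurableT_comp.
have -> : \int[Q]_w ((phi (X w) * g w)%R)%:E =
    lim (\int[Q]_w ((h n (X w) * g w)%R)%:E @[n --> \oo]).
  have cvghg w : ((h n (X w) * g w)%R)%:E @[n --> \oo] --> ((phi (X w) * g w)%R)%:E.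
    rewrite EFinM (_ : (fun n => _) = (fun n => (h n (X w))%:E * (g w)%:E)); last first.
      by apply/funext => n; rewrite EFinM.
    by apply: cvgeZr => //; exact: cvgh.
  under eq_integral => x _ do rewrite -(cvg_lim _ (cvghg x))//.
  apply: monotone_convergence => //.
  - by move=> n; apply/measurable_EFinP; exact: mhX.
  - by move=> n x _ /=; rewrite lee_fin mulr_ge0.
  - by move=> x _ a b ab; rewrite lee_fin ler_wpM2r// ndh.
have step n : \int[Q]_w ((h n (X w) * g w)%R)%:E = (\int[P]_x (h n x)%:E) * C%:E.
  under [in RHS]eq_integral do rewrite fimfunE -fsumEFin//.
  rewrite ge0_integral_fsum//; last 2 first.
  - by move=> r; apply/measurable_EFinP; exact: measurable_funM.
  - by move=> r x _; exact: nnfun_muleindic_ge0.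
  under eq_integral.
    move=> w _; rewrite EFinM fimfunE -fsumEFin// ge0_mule_fsuml; last first.
      by move=> r; exact: nnfun_muleindic_ge0.
    over.
  rewrite ge0_integral_fsum//; last 2 first.
  - move=> r; under eq_fun do rewrite -EFinM.
    apply/measurable_EFinP/measurable_funM => //.
    apply: measurable_funM => //.
    exact: (measurableT_comp (measurable_indic _)).
  - by move=> r x _; rewrite mule_ge0 ?lee_fin//; exact: nnfun_muleindic_ge0.
  rewrite ge0_mule_fsuml; last first.
    by move=> r; apply: integral_ge0 => x _; exact: nnfun_muleindic_ge0.
  apply: eq_fsbigr => r rh.
  have r0 : (0 <= r)%R by move: rh; rewrite inE => -[t _ <-].
  under eq_integral do rewrite -EFinM -mulrA EFinM.
  have mhr : measurable (h n @^-1` [set r]) by [].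
  rewrite ge0_integralZl//; last first.
  - by move=> w _; rewrite lee_fin mulr_ge0.
  - apply/measurable_EFinP/measurable_funM => //.
    exact: (measurableT_comp (measurable_indic _)).
  rewrite gC//.
  under [in RHS]eq_integral do rewrite EFinM.
  rewrite ge0_integralZl//; last first.
    exact/measurable_EFinP.
  by rewrite integral_indic// setIT muleA.
under eq_fun do rewrite step.
apply/cvg_lim => //.
apply: cvgeZr => //.
have ndI (a b : nat) : (a <= b)%N -> \int[P]_x (h a x)%:E <= \int[P]_x (h b x)%:E.
  have mhE m : measurable_fun setT (fun x => (h m x)%:E).
    by apply/measurable_EFinP; exact/measurable_funP.
  move=> ab; apply: ge0_le_integral => //.
  - by move=> x _; rewrite lee_fin.
  - by move=> x _; rewrite lee_fin ndh.
exact: ereal_nondecreasing_is_cvgn.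
Qed.

(** Induction on [k] over hybrid products: the first [k] factors are the [phi i], the others
    indicators of arbitrary measurable sets. The case 0 is the independence in [iid_sample]; since
    the set at index [k] is arbitrary, [integral_comp_mul] can exchange its indicator for [phi]. *)
Lemma iid_integral_prod n (X : 'I_n -> Omega -> T) (phi : 'I_n -> T -> R)
    (c : 'I_n -> R) :
  iid_sample Q P X -> (forall i, measurable_fun setT (phi i)) ->
  (forall i x, (0 <= phi i x)%R) ->
  (forall i, \int[P]_x (phi i x)%:E = (c i)%:E) ->
  \int[Q]_w ((\prod_(i < n) phi i (X i w))%R)%:E = ((\prod_(i < n) c i)%R)%:E.
Proof.
move=> [mX XP indX] mphi phi0 phic.
have c0 i : (0 <= c i)%R.
  by rewrite -lee_fin -phic; apply: integral_ge0 => x _; rewrite lee_fin.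
pose psi k (A : 'I_n -> set T) (i : 'I_n) x :=
  if (i < k)%N then phi i x else (\1_(A i) x : R).
pose e k (A : 'I_n -> set T) (i : 'I_n) : R :=
  if (i < k)%N then c i else fine (P (A i)).
have psi0 k A i x : (0 <= psi k A i x)%R by rewrite /psi; case: ifP.
have e0 k A i : (0 <= e k A i)%R by rewrite /e; case: ifP => // _; rewrite fine_ge0.
have mpsi k A i : (forall j, measurable (A j)) -> measurable_fun setT (psi k A i).
  by move=> mA; rewrite /psi; case: (i < k)%N; [exact: mphi|exact: measurable_indic].
suff key k (A : 'I_n -> set T) : (forall i, measurable (A i)) ->
    \int[Q]_w ((\prod_(i < n) psi k A i (X i w))%R)%:E =
    ((\prod_(i < n) e k A i)%R)%:E.
  have := key n (fun=> setT) (fun=> measurableT).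
  under eq_integral do under eq_bigr do rewrite /psi ltn_ord.
  by move=> ->; congr (_%:E); apply: eq_bigr => i _; rewrite /e ltn_ord.
elim: k A => [|k IH] A mA.
  have -> : (\prod_(i < n) e 0%N A i)%R%:E = \prod_(i < n) Q (X i @^-1` A i).
    rewrite -prodEFin; apply: eq_bigr => i _.
    by rewrite /e/= fineK ?fin_num_measure// XP.
  rewrite -indX//.
  have mI : measurable (\bigcap_(i in [set: 'I_n]) (X i @^-1` A i)).
    apply: fin_bigcap_measurable => // i _.
    by rewrite -[X in measurable X]setTI; exact: mX.
  rewrite -[X in Q X]setIT -(integral_indic Q measurableT mI).
  apply: eq_integral => w _; congr (_%:E).
  rewrite /psi/= indicE; case: (boolP (w \in _)) => [|].
    rewrite inE => wI; rewrite big1// => i _; rewrite indicE mem_set//.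
    exact: wI.
  move=> wI; apply/eqP; rewrite eq_sym/=.
  have /existsNP[i /not_implyP[_ wi]] : ~ (forall i : 'I_n, True -> A i (X i w)).
    by move=> h; move/negP : wI; apply; rewrite inE => i _; exact: h.
  by rewrite eq_sym (bigD1 i)//= indicE memNset// mul0r.
have [kn|nk] := ltnP k n; last first.
  have E B i : psi k.+1 B i = psi k B i.
    by rewrite /psi !(leq_trans (ltn_ord i)) // (leq_trans nk).
  under eq_integral do under eq_bigr do rewrite E.
  rewrite IH//; congr (_%:E); apply: eq_bigr => i _.
  by rewrite /e !(leq_trans (ltn_ord i)) // (leq_trans nk).
pose k0 := Ordinal kn.
pose g w := (\prod_(i < n | i != k0) psi k.+1 A i (X i w))%R.
pose C := (\prod_(i < n | i != k0) e k.+1 A i)%R.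
have ik (i : 'I_n) : i != k0 -> (i < k.+1)%N = (i < k)%N.
  by move=> ik0; rewrite ltnS leq_eqVlt -[i == k :> nat]/(i == k0) (negbTE ik0).
have -> : (\prod_(i < n) e k.+1 A i)%R%:E = \int[P]_x (phi k0 x)%:E * C%:E.
  by rewrite (bigD1 k0)//= EFinM phic /e/= ltnSn.
under eq_integral => w _.
  rewrite (bigD1 k0)//= -/(g w) {1}/psi/= ltnSn; over.
apply: integral_comp_mul => //.
- rewrite /g; under eq_fun do rewrite big_mkcond/=.
  apply: measurable_prod => i _; case: (i != k0) => //.
  by apply: measurableT_comp => //; exact: mpsi.
- by move=> w; apply: prodr_ge0.
move=> B mB.
pose A' i := if i == k0 then B else A i.
have mA' i : measurable (A' i) by rewrite /A'; case: ifP.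
have := IH A' mA'.
rewrite (bigD1 k0)//= {1}/e/= ltnn /A' eqxx EFinM fineK ?fin_num_measure//.
rewrite (_ : (\prod_(i < n | i != k0) _)%R = C); last first.
  by apply: eq_bigr => i ik0; rewrite /e/= ik// (negbTE ik0).
move=> <-; apply: eq_integral => w _; congr (_%:E).
rewrite [RHS](bigD1 k0)//= {1}/psi/= ltnn eqxx; congr (_ * _)%R.
by apply: eq_bigr => i ik0; rewrite /psi/= ik// (negbTE ik0).
Qed.

Lemma measurable_iid_prod_ge n (X : 'I_n -> Omega -> T) (phi : T -> R) (t : R) :
  iid_sample Q P X -> measurable_fun setT phi ->
  measurable [set w | (t <= \prod_(i < n) phi (X i w))%R].
Proof.
move=> [mX _ _] mphi.
have mp : measurable_fun setT (fun w => (\prod_(i < n) phi (X i w))%R).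
  by apply: measurable_prod => i _; apply: measurableT_comp.
rewrite (_ : [set _ | _] = (fun w => (\prod_(i < n) phi (X i w))%R) @^-1` `[t, +oo[).
  by rewrite -[X in measurable X]setTI; exact: mp.
by apply/seteqP; split => w /=; rewrite in_itv/= andbT.
Qed.

Lemma iid_markov n (X : 'I_n -> Omega -> T) (phi : T -> R) (K t : R) :
  iid_sample Q P X -> measurable_fun setT phi -> (forall x, (0 <= phi x)%R) ->
  \int[P]_x (phi x)%:E <= K%:E -> (0 < t)%R ->
  Q [set w | (t <= \prod_(i < n) phi (X i w))%R] <= (K ^+ n / t)%:E.
Proof.
move=> iid mphi phi0 phiK t0.
pose c := fine (\int[P]_x (phi x)%:E).
have I0 : 0 <= \int[P]_x (phi x)%:E by apply: integral_ge0 => x _; rewrite lee_fin.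
have Ic : \int[P]_x (phi x)%:E = c%:E.
  by rewrite fineK// ge0_fin_numE// (le_lt_trans phiK)// ltry.
have cK : (c <= K)%R by rewrite -lee_fin -Ic.
have c0 : (0 <= c)%R by rewrite -lee_fin -Ic.
have := iid_integral_prod iid (fun=> mphi) (fun=> phi0) (fun=> Ic).
rewrite prodr_const card_ord => E.
set A := [set w | _].
have mA : measurable A by exact: measurable_iid_prod_ge.
have mp : measurable_fun setT (fun w => (\prod_(i < n) phi (X i w))%R).
  by case: iid => mX _ _; apply: measurable_prod => i _; apply: measurableT_comp.
have : t%:E * Q A <= (c ^+ n)%:E.
  rewrite -E -[A]setIT -(integral_indic Q measurableT mA).
  have t0' : (0 <= t)%R by exact: ltW.
  rewrite -ge0_integralZl//; last first.
  - exact/measurable_EFinP.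
  have p0 w : (0 <= \prod_(i < n) phi (X i w))%R by exact: prodr_ge0.
  apply: ge0_le_integral => //.
  - by move=> w _; rewrite -EFinM lee_fin mulr_ge0.
  - by apply: measurable_funeM; exact/measurable_EFinP.
  - exact/measurable_EFinP.
  move=> w _; rewrite -EFinM lee_fin indicE.
  by case: (boolP (w \in A)) => [|_]; rewrite ?mulr0 ?mulr1// inE.
have QA : Q A = (fine (Q A))%:E by rewrite fineK// fin_num_measure.
rewrite QA -EFinM !lee_fin => h.
rewrite ler_pdivlMr// mulrC (le_trans h)//.
by rewrite lerXn2r// nnegrE (le_trans c0).
Qed.
End product_expectation.

(** * Bounded measurable functions, their means, and the averaged kernel inequality *)

Section bounded_measurable.
Context {R : realType} {d : measure_display} {T : measurableType d}
  (P : probability T R).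
Implicit Types f g : T -> R.

Definition bounded_measurable f :=
  measurable_fun setT f /\ exists C : R, forall x, `|f x| <= C.

Lemma bounded_measurable_cst (c : R) : bounded_measurable (cst c).
Proof. by split => //; exists `|c|. Qed.

Lemma bounded_measurableD f g : bounded_measurable f -> bounded_measurable g ->
  bounded_measurable (fun x => f x + g x).
Proof.
move=> [mf [C fC]] [mg [C' gC]]; split; first exact: measurable_funD.
by exists (C + C') => x; rewrite (le_trans (ler_normD _ _))// lerD.
Qed.

Lemma bounded_measurableM f g : bounded_measurable f -> bounded_measurable g ->
  bounded_measurable (fun x => f x * g x).
Proof.
move=> [mf [C fC]] [mg [C' gC]]; split; first exact: measurable_funM.
by exists (C * C') => x; rewrite normrM ler_pM.
Qed.

Lemma bounded_measurableZ (c : R) f : bounded_measurable f ->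
  bounded_measurable (fun x => c * f x).
Proof. by apply: (@bounded_measurableM (cst c)); exact: bounded_measurable_cst. Qed.

Lemma bounded_measurable_sum I (s : seq I) (F : I -> T -> R) :
  (forall i, bounded_measurable (F i)) ->
  bounded_measurable (fun x => \sum_(i <- s) F i x).
Proof.
move=> bF; elim: s => [|i s IH].
  by under eq_fun do rewrite big_nil; exact: bounded_measurable_cst.
by under eq_fun do rewrite big_cons; exact: bounded_measurableD.
Qed.

Lemma bounded_measurable_integrable f : bounded_measurable f ->
  P.-integrable setT (EFin \o f).
Proof.
move=> [mf [C fC]]; apply: measurable_bounded_integrable => //.
  by rewrite ltey_eq fin_num_measure.
exists C; split; first by rewrite num_real.
by move=> z Cz x _; exact: le_trans (fC x) (ltW Cz).
Qed.

Lemma PE_linear f g (a b : R) : bounded_measurable f -> bounded_measurable g ->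
  PE P (fun x => a * f x + b * g x) = a * PE P f + b * PE P g.
Proof.
move=> bf bg; rewrite /PE RintegralD//; last 2 first.
- by apply: bounded_measurable_integrable; exact: bounded_measurableZ.
- by apply: bounded_measurable_integrable; exact: bounded_measurableZ.
by rewrite !RintegralZl//; exact: bounded_measurable_integrable.
Qed.

Lemma PE_cst (c : R) : PE P (cst c) = c.
Proof.
rewrite /PE Rintegral_cst// (_ : fine _ = 1) ?mulr1//.
by rewrite -[RHS]/(fine 1%E); congr fine; exact: probability_setT.
Qed.

Lemma PE_sum (I : finType) (a : I -> R) (F : I -> T -> R) :
  (forall i, bounded_measurable (F i)) ->
  PE P (fun x => \sum_i a i * F i x) = \sum_i a i * PE P (F i).
Proof.
move=> bF; have bs s : bounded_measurable (fun x => \sum_(i <- s) a i * F i x).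
  by apply: bounded_measurable_sum => i; exact: bounded_measurableZ.
elim: (index_enum I) => [|i s IH].
  by under eq_fun do rewrite big_nil; rewrite big_nil (PE_cst 0).
rewrite big_cons -IH -[X in _ = _ + X]mul1r -PE_linear//.
by congr PE; apply/funext => x; rewrite big_cons mul1r.
Qed.

Section over_finite_family.
Context {D : finType} (Y : D -> T -> R).
Hypothesis bY : forall d, bounded_measurable (Y d).

Lemma bounded_measurable_sgnE (l : seq D) (g : R -> R) (t : R) :
  bounded_measurable (fun x => sgnE (map (Y^~ x) l) g t).
Proof.
elim: l t => [|j l IH] t /=; first exact: bounded_measurable_cst.
have half (e : R) : bounded_measurable (fun x => (1 + e * Y j x) / 2).
  under eq_fun do rewrite mulrC; apply: bounded_measurableZ.
  apply: (@bounded_measurableD (cst 1)); first exact: bounded_measurable_cst.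
  exact: bounded_measurableZ.
apply: bounded_measurableD; apply: bounded_measurableM => //.
  by have := half 1; under eq_fun do rewrite mul1r.
by have := half (-1); under eq_fun do rewrite mulN1r.
Qed.

Lemma bounded_measurable_tuple_mean (p : D -> R) M (F : seq D -> T -> R) :
  (forall l, bounded_measurable (F l)) ->
  bounded_measurable (fun x => tuple_mean p M (F^~ x)).
Proof.
elim: M F => [|M IH] F bF /=; first exact: bF.
by apply: bounded_measurable_sum => j; apply: bounded_measurableZ; exact: IH.
Qed.

Lemma PE_tuple_mean (p : D -> R) M (F : seq D -> T -> R) :
  (forall l, bounded_measurable (F l)) ->
  PE P (fun x => tuple_mean p M (F^~ x)) = tuple_mean p M (fun l => PE P (F l)).
Proof.
elim: M F => [|M IH] F bF //=.
rewrite PE_sum; last by move=> j; exact: bounded_measurable_tuple_mean.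
by apply: eq_bigr => j _; rewrite (IH (fun l => F (j :: l))).
Qed.

(** The hypothesis on tuples is averaged with weights [p]. Its right side becomes
    [- n * s * P(y^2) + b], because the kernel has mean [1 - s * y^2]; its left side is bounded
    below pointwise by [sgnE_ln_le] and [sgnE_ln_kern]. *)
Lemma empirical_quadratic_lower n (xs : 'I_n -> T) (p : D -> R) (y : T -> R)
    M (s b : R) :
  (12 <= M)%N -> 0 < s <= 7/10 -> (forall x, y x = \sum_j p j * Y j x) ->
  (forall j, 0 <= p j) -> \sum_j p j = 1 ->
  (forall j x, `|Y j x| <= 1) ->
  (forall l : seq D, size l = M ->
    \sum_(i < n) ln (sgnE (map (Y^~ (xs i)) l) (kern M s) 0) <=
    n%:R * (PE P (fun x => sgnE (map (Y^~ x) l) (kern M s) 0) - 1) + b) ->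
  n%:R * (s * PE P (fun x => y x ^+ 2)) <=
  n%:R * kern_offset M s + kern_slope s * \sum_(i < n) y (xs i) ^+ 2 + b.
Proof.
move=> M12 s01 yE p0 p1 Y1 H.
have y1 x : `|y x| <= 1.
  rewrite yE (le_trans (ler_norm_sum _ _ _))// -p1; apply: ler_sum => j _.
  by rewrite normrM (ger0_norm (p0 j)) ler_piMr.
have by2 : bounded_measurable (fun x => y x ^+ 2).
  have by1 : bounded_measurable y.
    rewrite (funext yE).
    by apply: bounded_measurable_sum => j; exact: bounded_measurableZ.
  exact: bounded_measurableM.
have bl x l : unit_bounded (map (Y^~ x) l).
  by apply/allP => _ /mapP[j _ ->].
pose F (l : seq D) x := sgnE (map (Y^~ x) l) (kern M s) 0.
have Hl (l : seq D) : size l = M -> 1 * (\sum_(i < n) ln (F l (xs i))) + 0 * cst 0 l <=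
     n%:R * PE P (F l) + (b - n%:R) * cst 1 l.
  by move=> /H; rewrite /F /=; lra.
have := tuple_mean_le p0 Hl.
rewrite !tuple_mean_lin tuple_mean_sum tuple_mean_cst// tuple_mean_cst// -PE_tuple_mean; last first.
  by move=> l; exact: bounded_measurable_sgnE.
have -> : (fun x => tuple_mean p M (F^~ x)) = (fun x => 1 * cst 1 x + (- s) * y x ^+ 2).
  by apply/funext => x; rewrite tuple_mean_sgnE// sgnE_kern//= -yE mul1r mulNr.
rewrite PE_linear//; last exact: bounded_measurable_cst.
rewrite PE_cst mul1r mul0r addr0.
have : \sum_(i < n) - (kern_offset M s + kern_slope s * y (xs i) ^+ 2) <=
    \sum_(i < n) tuple_mean p M (fun l => ln (F l (xs i))).
  apply: ler_sum => i _; apply: (le_trans (sgnE_ln_kern M12 s01 (y1 (xs i)))).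
  rewrite yE -(@tuple_mean_sgnE _ _ p M (Y^~ (xs i)))//; apply: tuple_mean_le => // l lM.
  apply: (@sgnE_ln_le _ _ _ M%:R) => //.
    by rewrite normr0 add0r size_map lM.
  by move=> u; exact: kern_gt0.
rewrite sumrN big_split/= sumr_const card_ord -mulr_sumr -mulr_natl; lra.
Qed.
End over_finite_family.
End bounded_measurable.

(** * Exponential deviation for one fixed tuple *)

Section empirical_kernel_event.
Context {R : realType} {d d' : measure_display} {T : measurableType d}
  {Omega : measurableType d'} (P : probability T R) (Q : probability Omega R).
Context {D : finType} (Y : D -> T -> R) (n : nat) (X : 'I_n -> Omega -> T).
Hypothesis iid : iid_sample Q P X.
Hypothesis bY : forall j, bounded_measurable (Y j).
Hypothesis Y1 : forall j x, `|Y j x| <= 1.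

(** Markov's inequality at the threshold [expR b * K ^+ n], where [K] is the mean of one factor.
    After taking logarithms, [ln K <= K - 1] makes the bound linear in the mean, so that it can be
    averaged over tuples. *)
Lemma kernel_event M (s b : R) (l : seq D) : (12 <= M)%N -> 0 < s <= 7/10 ->
  size l = M ->
  exists B : set Omega, [/\ measurable B, (Q B <= (expR (- b))%:E)%E &
    forall w, ~ B w ->
      \sum_(i < n) ln (sgnE (map (Y^~ (X i w)) l) (kern M s) 0) <=
      n%:R * (PE P (fun x => sgnE (map (Y^~ x) l) (kern M s) 0) - 1) + b].
Proof.
move=> M12 s01 lM; pose F x := sgnE (map (Y^~ x) l) (kern M s) 0.
have bl x : unit_bounded (map (Y^~ x) l).
  by apply/allP => _ /mapP[j _ ->].
have F0 x : 0 < F x.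
  apply: (@sgnE_gt0 _ _ _ M%:R) => //; first by rewrite normr0 add0r size_map lM.
  by move=> u; exact: kern_gt0.
have bF : bounded_measurable F by exact: bounded_measurable_sgnE.
have iF := bounded_measurable_integrable P bF.
pose K := PE P F.
have EK : (\int[P]_x (F x)%:E = K%:E)%E.
  by rewrite /K /PE /Rintegral fineK//; exact: integrable_fin_num.
have K0 : 0 < K.
  apply: (@lt_le_trans _ _ (PE P (cst (3/10)))); first by rewrite PE_cst; lra.
  apply: le_Rintegral => //.
    exact: (bounded_measurable_integrable P (bounded_measurable_cst _)).
  move=> x _; rewrite -(sgnE_cst (map (Y^~ x) l) (3/10) 0).
  apply: (@sgnE_le _ _ _ _ M%:R) => //; first by rewrite normr0 add0r size_map lM.
  by move=> u; exact: kern_ge.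
exists [set w | expR b * K ^+ n <= \prod_(i < n) F (X i w)]; split.
- by apply: measurable_iid_prod_ge iid _; case: bF.
- have := @iid_markov _ _ _ _ _ P Q n X F K (expR b * K ^+ n) iid.
  have [mF _] := bF; move=> /(_ mF (fun x => ltW (F0 x))).
  rewrite EK => /(_ (lexx _)); rewrite mulr_gt0 ?expR_gt0 ?exprn_gt0// => /(_ isT).
  rewrite invfM mulrCA divff ?mulr1 ?expRN//.
  by rewrite gt_eqF// exprn_gt0.
move=> w /negP; rewrite -ltNge => /ltW h.
have P0 : 0 < \prod_(i < n) F (X i w) by rewrite prodr_gt0.
have : ln (\prod_(i < n) F (X i w)) <= ln (expR b * K ^+ n).
  by rewrite ler_ln ?posrE// mulr_gt0 ?expR_gt0// exprn_gt0.
rewrite lnM ?posrE ?expR_gt0 ?exprn_gt0// expRK lnXn//.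
have [_ ->] : 0 < \prod_(i < n) F (X i w) /\
    ln (\prod_(i < n) F (X i w)) = \sum_(i < n) ln (F (X i w)).
  elim/big_rec2 : _ => [|i y x _ [x0 <-]]; first by rewrite ltr01 ln1.
  by rewrite mulr_gt0// lnM ?posrE.
have lnK1 : ln K <= K - 1.
  have := @le_ln1Dx R (K - 1); rewrite addrCA subrr addr0; apply; lra.
move=> /le_trans; apply.
have := ler_wpM2l (ler0n R n) lnK1.
by rewrite -/F -/K -(mulr_natl (ln K)); lra.
Qed.
End empirical_kernel_event.

(** * Sub-Gaussian bounds *)

Section moment_generating_functions.
Context {R : realType} {d : measure_display} {T : measurableType d}
  (P : probability T R).
Implicit Types (h eps g : T -> R) (U tau l : R).

(** Lets the dominating function be treated by real linearity of [PE] while integrability of [g1] is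
    not yet known. *)
Lemma ge0_le_integral_fin g1 g2 (c : R) : measurable_fun setT g1 ->
  P.-integrable setT (EFin \o g2) -> PE P g2 <= c ->
  (forall x, 0 <= g1 x <= g2 x) -> (\int[P]_x (g1 x)%:E <= c%:E)%E.
Proof.
move=> mg1 ig2 g2c g12.
have -> : (c%:E = (c - PE P g2)%:E + \int[P]_x (g2 x)%:E)%E.
  have -> : (\int[P]_x (g2 x)%:E = (PE P g2)%:E)%E.
    by rewrite /PE /Rintegral fineK//; exact: integrable_fin_num.
  by rewrite -EFinD subrK.
apply: (@le_trans _ _ (\int[P]_x (g2 x)%:E)%E); last first.
  by rewrite leeDr// lee_fin subr_ge0.
apply: ge0_le_integral => //.
- by move=> x _; rewrite lee_fin; have /andP[] := g12 x.
- exact/measurable_EFinP.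
- by have /integrableP[] := ig2.
- by move=> x _; rewrite lee_fin; have /andP[] := g12 x.
Qed.

(** Hoeffding's lemma on a symmetric interval: the chord bound has mean cosh(l U). *)
Lemma mgf_bounded h U l : measurable_fun setT h -> 0 < U ->
  (forall x, `|h x| <= U) -> PE P h = 0 ->
  (\int[P]_x (expR (l * h x))%:E <= (expR (l ^+ 2 * U ^+ 2 / 2))%:E)%E.
Proof.
move=> mh U0 hU Eh.
have bh : bounded_measurable h by split => //; exists U.
pose a := (expR (l * U) + expR (- (l * U))) / 2.
pose b := (expR (l * U) - expR (- (l * U))) / (2 * U).
have b1 := bounded_measurable_cst (1 : R) : bounded_measurable (cst 1 : T -> R).
apply: (@ge0_le_integral_fin _ (fun x => a * cst 1 x + b * h x)).
- by apply: measurableT_comp => //; exact: measurable_funM.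
- apply: bounded_measurable_integrable; apply: bounded_measurableD;
    exact: bounded_measurableZ.
- rewrite PE_linear// PE_cst Eh mulr0 addr0 mulr1 /a -exprMn.
  have := cosh_le_expR_sqr (l * U); lra.
move=> x; rewrite expR_ge0/= mulr1.
by have := expR_convex_bound l U0 (hU x); rewrite /a /b [b * _]mulrC.
Qed.

(** Since [|l * h * eps| <= |l * U * eps|], [expR_le_cosh] removes [h] from the exponentials; the
    linear term has mean 0 by hypothesis. The factor 2 in the variance proxy is the price. *)
Lemma mgf_bounded_mul h eps U tau l : measurable_fun setT h ->
  measurable_fun setT eps -> 0 < U -> (forall x, `|h x| <= U) ->
  subgaussian P (tau ^+ 2) eps ->
  P.-integrable setT (EFin \o (fun x => h x * eps x)) ->
  PE P (fun x => h x * eps x) = 0 ->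
  (\int[P]_x (expR (l * (h x * eps x)))%:E
     <= (expR (l ^+ 2 * (2 * (U ^+ 2 * tau ^+ 2)) / 2))%:E)%E.
Proof.
move=> mh meps U0 hU sg iheps Eheps.
set v := l ^+ 2 * U ^+ 2 * tau ^+ 2 / 2.
have sgE (s : R) : s ^+ 2 = l ^+ 2 * U ^+ 2 ->
    P.-integrable setT (EFin \o (fun x => expR (s * eps x))) /\
    PE P (fun x => expR (s * eps x)) <= expR v.
  move=> sE; have ms : measurable_fun setT (fun x => expR (s * eps x)).
    by apply: measurableT_comp => //; exact: measurable_funM.
  have h1 := sg s; rewrite sE -/v in h1.
  have is_ : P.-integrable setT (EFin \o (fun x => expR (s * eps x))).
    apply/integrableP; split; first exact/measurable_EFinP.
    under eq_integral do rewrite /= ger0_norm ?expR_ge0//.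
    by rewrite (le_lt_trans h1)// ltry.
  split => //; rewrite -lee_fin /PE /Rintegral fineK//.
  exact: integrable_fin_num.
have [i1 e1] : P.-integrable setT (EFin \o (fun x => expR (l * U * eps x))) /\
    PE P (fun x => expR (l * U * eps x)) <= expR v.
  by apply: sgE; rewrite exprMn.
have [i2 e2] : P.-integrable setT (EFin \o (fun x => expR (- (l * U) * eps x))) /\
    PE P (fun x => expR (- (l * U) * eps x)) <= expR v.
  by apply: sgE; rewrite sqrrN exprMn.
have i0 : P.-integrable setT (EFin \o (fun x => l * (h x * eps x))).
  rewrite (_ : EFin \o _ = (fun x => (l%:E * (h x * eps x)%R%:E)%E)).
    exact: integrableZl.
  by apply/funext => x; rewrite /= EFinM.
have i12 : P.-integrable setT (EFin \o (fun x => expR (l * U * eps x) + expR (- (l * U) * eps x))).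
  exact: (integrableD measurableT i1 i2).
have i3 : P.-integrable setT (EFin \o (cst (-1) : T -> R)).
  exact: (bounded_measurable_integrable P (bounded_measurable_cst _)).
have i03 : P.-integrable setT (EFin \o (fun x => l * (h x * eps x) + cst (-1) x)).
  exact: (integrableD measurableT i0 i3).
apply: (@ge0_le_integral_fin _ (fun x => (l * (h x * eps x) + cst (-1) x) +
   (expR (l * U * eps x) + expR (- (l * U) * eps x)))).
- by apply: measurableT_comp => //; apply: measurable_funM => //; exact: measurable_funM.
- exact: (integrableD measurableT i03 i12).
- rewrite /PE RintegralD// RintegralD// RintegralD// RintegralZl//.
  move: Eheps e1 e2 (PE_cst P (-1)); rewrite /PE => -> e1 e2 ->.
  have -> : l ^+ 2 * (2 * (U ^+ 2 * tau ^+ 2)) / 2 = 2%:R * v by rewrite /v; field.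
  rewrite expRM_natl.
  (* The mean is now at most [2 * expR v - 1], which is at most [expR v ^+ 2]. *)
  have := sqr_ge0 (expR v - 1); lra.
move=> x; rewrite expR_ge0/=.
have := @expR_le_cosh _ (l * (h x * eps x)) (l * U * eps x) _.
rewrite mulNr; have -> : `|l * (h x * eps x)| <= `|l * U * eps x|.
  rewrite !normrM -mulrA ler_wpM2l// (gtr0_norm U0) ler_wpM2r//.
by move=> /(_ isT); lra.
Qed.
End moment_generating_functions.

Section gaussian_square.
Context {R : realType}.
Notation mu := (@lebesgue_measure R).

Lemma integral_expR_normal_pdf (l : R) :
  (\int[mu]_u (expR (l * u) * normal_pdf 0 1 u)%:E = (expR (l ^+ 2 / 2))%:E)%E.
Proof.
transitivity (\int[mu]_u ((expR (l ^+ 2 / 2))%:E * (normal_pdf l 1 u)%:E))%E.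
  apply: eq_integral => u _; rewrite -EFinM; congr (_%:E).
  rewrite !normal_pdfE ?oner_neq0// /normal_fun [in LHS]mulrCA [in RHS]mulrCA.
  congr (_ * _); rewrite -!expRD; congr expR.
  by rewrite expr1n subr0; field.
have mpdf : measurable_fun setT (fun u : R => (normal_pdf l 1 u)%:E).
  by apply/measurable_EFinP; exact: measurable_normal_pdf.
have pdf0 (u : R) : setT u -> (0 <= (normal_pdf l 1 u)%:E)%E.
  by rewrite lee_fin normal_pdf_ge0.
rewrite ge0_integralZl// ?lee_fin ?expR_ge0//.
by rewrite integral_normal_pdf mule1.
Qed.

(** As 1/10 - 1/2 = -1/(2 * 5/4), the integrand is sqrt(5/4) times the centered Gaussian density of
    variance 5/4. *)
Lemma integral_expR_sqr_normal_pdf :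
  (\int[mu]_u (expR (u ^+ 2 / 10) * normal_pdf 0 1 u)%:E = (Num.sqrt (5 / 4))%:E)%E.
Proof.
set s : R := Num.sqrt (5 / 4).
have s2 : s ^+ 2 = 5 / 4 by rewrite sqr_sqrtr//; lra.
have s0 : 0 < s by rewrite sqrtr_gt0; lra.
transitivity (\int[mu]_u (s%:E * (normal_pdf 0 s u)%:E))%E.
  apply: eq_integral => u _; rewrite -EFinM; congr (_%:E).
  rewrite !normal_pdfE ?oner_neq0 ?gt_eqF// /normal_fun [in LHS]mulrCA [in RHS]mulrA.
  congr (_ * _); last first.
    rewrite -!expRD; congr expR.
    by rewrite expr1n subr0 s2; field.
  rewrite /normal_peak expr1n mul1r -mulrnAr sqrtrM ?sqr_ge0// sqrtr_sqr gtr0_norm//.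
  by rewrite invfM mulrA divff ?mul1r ?gt_eqF.
have mpdf : measurable_fun setT (fun u : R => (normal_pdf 0 s u)%:E).
  by apply/measurable_EFinP; exact: measurable_normal_pdf.
have pdf0 (u : R) : setT u -> (0 <= (normal_pdf 0 s u)%:E)%E.
  by rewrite lee_fin normal_pdf_ge0.
rewrite ge0_integralZl// ?lee_fin ?(ltW s0)//.
by rewrite integral_normal_pdf mule1.
Qed.

(* exp(x^2/10) is the average of exp(u x / sqrt 5) over a standard Gaussian [u]. *)
Lemma subgaussian_sqr d (T : measurableType d) (P : probability T R) (eps : T -> R)
    (tau : R) : 0 < tau -> measurable_fun setT eps -> subgaussian P (tau ^+ 2) eps ->
  (\int[P]_x (expR (eps x ^+ 2 / (10 * tau ^+ 2)))%:E <= (Num.sqrt (5 / 4))%:E)%E.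
Proof.
move=> tau0 meps sg.
pose k : R := (Num.sqrt 5 * tau)^-1.
have k2 : k ^+ 2 = (5 * tau ^+ 2)^-1 by rewrite /k exprVn exprMn sqr_sqrtr.
pose f (z : T * R) : \bar R := (expR (k * eps z.1 * z.2) * normal_pdf 0 1 z.2)%:E.
have mf : measurable_fun setT f.
  apply/measurable_EFinP; apply: measurable_funM.
    apply: measurableT_comp => //; apply: measurable_funM => //.
    by apply: measurable_funM => //; exact: measurableT_comp.
  apply: measurableT_comp => //; exact: measurable_normal_pdf.
have f0 z : (0 <= f z)%E by rewrite lee_fin mulr_ge0 ?expR_ge0 ?normal_pdf_ge0.
have -> : (\int[P]_x (expR (eps x ^+ 2 / (10 * tau ^+ 2)))%:E =
    \int[P]_x \int[mu]_u f (x, u))%E.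
  apply: eq_integral => x _; rewrite /f/= integral_expR_normal_pdf.
  by rewrite exprMn k2; congr (expR _)%:E; field; rewrite gt_eqF.
rewrite (@fubini_tonelli _ _ _ _ _ P mu f mf f0)/=.
rewrite -integral_expR_sqr_normal_pdf.
apply: ge0_le_integral => //.
- by move=> u _; apply: integral_ge0.
- exact: (@measurable_fun_fubini_tonelli_G _ _ _ _ _ P f mf f0).
- apply/measurable_EFinP; apply: measurable_funM; last exact: measurable_normal_pdf.
  by apply: measurableT_comp => //; apply: measurable_funM.
move=> u _; rewrite /f/=.
under eq_integral do rewrite mulrC EFinM.
have me : measurable_fun setT (fun x => (expR (k * eps x * u))%:E).
  apply/measurable_EFinP; apply: measurableT_comp => //.
  by apply: measurable_funM => //; exact: measurable_funM.
have e0 x : setT x -> (0 <= (expR (k * eps x * u))%:E)%E by rewrite lee_fin expR_ge0.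
rewrite ge0_integralZl// ?lee_fin ?normal_pdf_ge0//.
rewrite mulrC EFinM lee_wpmul2l// ?lee_fin ?normal_pdf_ge0//.
have := sg (k * u).
have -> : ((k * u) ^+ 2 * tau ^+ 2 / 2 = u ^+ 2 / 10)%R.
  by rewrite exprMn k2; field; rewrite gt_eqF.
apply: le_trans; rewrite le_eqVlt; apply/orP; left; apply/eqP.
by apply: eq_integral => x _; congr (expR _)%:E; ring.
Qed.
End gaussian_square.

(** * Numerical choice of the kernel *)

(** Tangents for the square of [a] and chords for 1/V make the numerical inequalities linear; the
    tangent is taken at the smallest admissible value of [a]. *)
Lemma sqr_ge_tangent (R : realType) (a0 a : R) : 2 * a0 * a - a0 ^+ 2 <= a ^+ 2.
Proof. by have := sqr_ge0 (a - a0); lra. Qed.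

Lemma invr_le_chord (R : realType) (p q V : R) :
  0 < p -> p <= V <= q -> V^-1 <= (p + q - V) / (p * q).
Proof.
move=> p0 /andP[pV Vq]; rewrite ler_pdivlMr; last by nra.
rewrite mulrC ler_pdivrMr; last by lra.
have : 0 <= (V - p) * (q - V) by rewrite mulr_ge0//; lra.
lra.
Qed.

Lemma ler_invr (R : realType) (b N : R) : 0 < b -> b <= N -> N^-1 <= b^-1.
Proof. by move=> b0 bN; rewrite lef_pV2 ?posrE//; lra. Qed.

Lemma kern_moments12 (R : realType) :
  kern_moment2 12 = 66^-1 :> R /\ kern_moment3 12 = 5 / (33 * 33) :> R.
Proof. by rewrite /kern_moment2 /kern_moment3; split; field. Qed.

Lemma kern_moments24 (R : realType) :
  kern_moment2 24 = 276^-1 :> R /\ kern_moment3 24 = 11 / (138 * 138) :> R.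
Proof. by rewrite /kern_moment2 /kern_moment3; split; field. Qed.

Lemma kern_moments40 (R : realType) :
  kern_moment2 40 = 780^-1 :> R /\ kern_moment3 40 = 19 / (390 * 390) :> R.
Proof. by rewrite /kern_moment2 /kern_moment3; split; field. Qed.

(** For [s = k / V] the inequality carries a common factor 1/V; once it is removed, all terms stay
    bounded as [V] grows. *)
Lemma kernel_rescale (R : realType) M (k V a e : R) : 0 < V ->
  M%:R + (55/100 * k ^+ 2 * kern_moment2 M + 3/4 * k ^+ 3 * kern_moment3 M * V^-1) / 16
  + (k + 55/100 * k ^+ 2 * V^-1 + 3/4 * k ^+ 3 * (V^-1 * V^-1)) * e < k * a ^+ 2 ->
  M%:R / V + kern_offset M (k * V^-1) * (V / 16) + kern_slope (k * V^-1) * e < k * V^-1 * a ^+ 2.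
Proof.
move=> V0; rewrite -(ltr_pM2r (x := V^-1)) ?invr_gt0//.
rewrite (_ : k * V^-1 * a ^+ 2 = k * a ^+ 2 * V^-1); last by ring.
apply: le_lt_trans; rewrite le_eqVlt; apply/orP; left; apply/eqP.
by rewrite /kern_offset /kern_slope; field; rewrite gt_eqF.
Qed.

Lemma kernel_parameters_large (R : realType) (V a N : R) :
  1000 <= V -> 128 <= N -> N <= V -> V <= 2 * N ->
  1 - 2 * a <= 311/1000 -> 1 - 2 * a <= N * (5 / (4 * 4 * 48 * 49)) ->
  40%:R + (55/100 * 700 ^+ 2 * kern_moment2 40 + 3/4 * 700 ^+ 3 * kern_moment3 40 * V^-1) / 16
  + (700 + 55/100 * 700 ^+ 2 * V^-1 + 3/4 * 700 ^+ 3 * (V^-1 * V^-1))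
    * ((2 * a - 689/1000) / 48 + 2 / N) < 700 * a ^+ 2.
Proof.
move=> V1000 N128 NV V2N h1 h2.
have V0 : 0 < V by clear -V1000; lra.
have iV0 : 0 < V^-1 by rewrite invr_gt0.
have iV1 : V^-1 <= 1000^-1 by apply: ler_invr; clear -V1000; lra.
have N0 : 0 < N by clear -N128; lra.
have hN : N^-1 <= 2 * V^-1.
  by have := ler_invr V0 V2N; rewrite invfM; clear; lra.
have iV2 : V^-1 * V^-1 <= 1000^-1 * V^-1 by rewrite ler_wpM2r// ltW.
have iN0 : 0 <= N^-1 by rewrite invr_ge0 ltW.
have hV2000 : 2000 < V -> V^-1 <= 2000^-1 by move=> h; apply: ler_invr; clear -h; lra.
move: V^-1 iV0 iV1 hN iV2 hV2000 => i iV0 iV1 hN iV2 hV2000.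
move: N^-1 hN iN0 => iN hN iN0.
have C : (55 / 100 * 700 ^+ 2 * kern_moment2 40
    + 3 / 4 * 700 ^+ 3 * kern_moment3 40 * i) / 16 <= 24 :> R.
  by rewrite (kern_moments40 R).1 (kern_moments40 R).2; clear -iV1; lra.
have g1 : 700 + 55/100 * 700 ^+ 2 * i + 3/4 * 700 ^+ 3 * (i * i) <= 1227 :> R.
  by clear -iV1 iV2; lra.
move: (_ / 16) C => c C; move: (700 + _ + _) g1 => g g1.
have e0 : 0 <= (2 * a - 689 / 1000) / 48 + 2 * iN by clear -iN0 h1; lra.
have := ler_wpM2r e0 g1; move: (g * _) => ge hge.
(* Up to 2000 the bound proportional to [N] gives [a >= 367/1000]. Beyond, only
   [1 - 2 * a <= 311/1000] is left, but then 1/N <= 1/1000. *)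
have [V2000|/hV2000 iV3] := leP V 2000.
  have ha : 367/1000 <= a by clear -h2 NV V2000; lra.
  have := sqr_ge_tangent (367/1000) a; clear -C hge ha hN iV1; lra.
have ha : 3445/10000 <= a by clear -h1; lra.
have := sqr_ge_tangent (3445/10000) a; clear -C hge ha hN iV3; lra.
Qed.

(* Used with [N = n / (xi L)] and [V = max N (16 xi)]; the values of [M] and [s] come from a
   numerical optimisation on each of the ranges [V <= 230], [230 < V <= 1000] and [1000 < V]. *)
Lemma kernel_parameters (R : realType) (V : R) : 128 <= V -> exists (M : nat) (s : R),
  [/\ (12 <= M)%N, 0 < s <= 7/10 & forall a N : R, 128 <= N -> N <= V -> V <= 2 * N ->
    1 - 2 * a <= 311/1000 -> 1 - 2 * a <= N * (5 / (4 * 4 * 48 * 49)) ->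
    M%:R / V + kern_offset M s * (V / 16)
      + kern_slope s * ((2 * a - 689/1000) / 48 + 2 / N) < s * a ^+ 2].
Proof.
move=> V128.
have [V230|V230] := leP V 230.
  exists 12%N, (7/10); split => //; first by clear; lra.
  move=> a N N128 NV _ _ h.
  (* Rounded down from (1 - 230 * 5/(16 * 48 * 49))/2, as [N <= V <= 230]; the values 4667 and 4335
     below come from 500 and 1000 likewise. *)
  have ha : 4847/10000 <= a by lra.
  have := sqr_ge_tangent (4847/10000) a.
  have := @invr_le_chord R 128 230 V; rewrite V128 V230 => /(_ _ isT); rewrite ltr0n => /(_ isT) hV.
  have hN : N^-1 <= 128^-1 by apply: ler_invr => //; rewrite ltr0n.
  rewrite /kern_offset (kern_moments12 R).1 (kern_moments12 R).2 /kern_slope; lra.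
have [V1000|V1000] := leP V 1000.
  exists 24%N, (7/10); split => //; first by clear; lra.
  move=> a N N128 NV _ _ h.
  have hN : N^-1 <= 128^-1 by apply: ler_invr => //; rewrite ltr0n.
  have [V500|V500] := leP V 500.
    have ha : 4667/10000 <= a by lra.
    have := sqr_ge_tangent (4667/10000) a.
    have := @invr_le_chord R 230 500 V; rewrite (ltW V230) V500 => /(_ _ isT).
    rewrite ltr0n => /(_ isT) hV.
    rewrite /kern_offset (kern_moments24 R).1 (kern_moments24 R).2 /kern_slope; lra.
  have ha : 4335/10000 <= a by lra.
  have := sqr_ge_tangent (4335/10000) a.
  have := @invr_le_chord R 500 1000 V; rewrite (ltW V500) V1000 => /(_ _ isT).
  rewrite ltr0n => /(_ isT) hV.
  rewrite /kern_offset (kern_moments24 R).1 (kern_moments24 R).2 /kern_slope; lra.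
have V0 : 0 < V by lra.
exists 40%N, (700 * V^-1); split => //.
  rewrite mulr_gt0 ?invr_gt0 ?ltr0n// ler_pdivrMr//.
  by clear -V1000; lra.
move=> a N N128 NV V2N h1 h2.
apply: kernel_rescale => //; apply: kernel_parameters_large => //; exact: ltW.
Qed.

(** * The LASSO error *)

Section lasso.
Context {R : realType} {T : Type} {n m : nat} (x : 'I_n -> T).
Implicit Types (g : T -> R).

Lemma PnD g1 g2 : Pn x (fun t => g1 t + g2 t) = Pn x g1 + Pn x g2.
Proof. by rewrite /Pn big_split/= mulrDr. Qed.

Lemma PnZ (a : R) g : Pn x (fun t => a * g t) = a * Pn x g.
Proof. by rewrite /Pn -mulr_sumr mulrCA. Qed.

Lemma Pn_sum (g : 'I_m -> T -> R) :
  Pn x (fun t => \sum_(j < m) g j t) = \sum_(j < m) Pn x (g j).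
Proof. by rewrite /Pn exchange_big/= mulr_sumr. Qed.

Lemma Pn_cst (c : R) : (0 < n)%N -> Pn x (fun=> c) = c.
Proof.
move=> n0; rewrite /Pn sumr_const card_ord -[c *+ n]mulr_natl mulrA mulVf ?mul1r//.
by rewrite pnatr_eq0 -lt0n.
Qed.

Lemma Pn_sum_sqr_center g : (0 < n)%N ->
  Pn x (fun t => (g t - Pn x g) ^+ 2) = Pn x (fun t => g t ^+ 2) - Pn x g ^+ 2.
Proof.
move=> n0; set c := Pn x g.
have -> : (fun t => (g t - c) ^+ 2) = (fun t => g t ^+ 2 + ((- 2 * c) * g t + c ^+ 2)).
  by apply/funext => t; ring.
by rewrite PnD PnD PnZ Pn_cst// -/c; ring.
Qed.

Lemma Pn_cauchy_schwarz g1 g2 :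
  Pn x (fun t => g1 t * g2 t) ^+ 2 <= Pn x (fun t => g1 t ^+ 2) * Pn x (fun t => g2 t ^+ 2).
Proof.
set A := Pn x (fun t => g1 t ^+ 2); set C := Pn x (fun t => g2 t ^+ 2).
set B := Pn x _.
have A0 : 0 <= A by rewrite /A /Pn mulr_ge0 ?invr_ge0// sumr_ge0// => i _; exact: sqr_ge0.
have C0 : 0 <= C by rewrite /C /Pn mulr_ge0 ?invr_ge0// sumr_ge0// => i _; exact: sqr_ge0.
have h (p q : R) : 0 <= p ^+ 2 * A + (2 * p * q) * B + q ^+ 2 * C.
  rewrite /A /B /C -!PnZ -!PnD /Pn mulr_ge0 ?invr_ge0// sumr_ge0// => i _.
  rewrite (_ : _ + _ = (p * g1 (x i) + q * g2 (x i)) ^+ 2) ?sqr_ge0//; ring.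
have [C00|C00] := eqVneq C 0.
  have [->|B0] := eqVneq B 0; first by rewrite expr0n/= C00 mulr0.
  (* With [C = 0] the form is affine in [q]; this [q] gives it the negative value [- A - 2]. *)
  have := h 1 (- (A + 1) / B); rewrite C00 mulr0 addr0 expr1n mul1r.
  rewrite (_ : 2 * 1 * _ * B = - 2 * (A + 1)); last by field.
  by lra.
have Cp : 0 < C by rewrite lt_def C00.
have := h C (- B); rewrite (_ : _ + _ = C * (A * C - B ^+ 2)); last by ring.
by rewrite pmulr_rge0// subr_ge0.
Qed.

Variables (f : T -> R) (h : 'I_m -> T -> R) (lam : R).

(* Moving from [b] towards [bs] by a step [th] and letting [th] tend to 0 keeps the whole quadratic
   term, of which comparing the two end points would lose one half. *)
Lemma lasso_three_point (b bs : 'I_m -> R) (c : R) (e Y : T -> R) :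
  (0 < n)%N -> 0 <= lam -> lasso_minimizer x f h lam b ->
  (forall t, e t = f t - c - \sum_(j < m) bs j * h j t) ->
  (forall t, Y t = \sum_(j < m) (b j - bs j) * h j t) ->
  Pn x (fun t => (Y t - Pn x Y) ^+ 2)
    + lam * (\sum_(j < m) `|b j| - \sum_(j < m) `|bs j|)
  <= Pn x (fun t => e t * (Y t - Pn x Y)).
Proof.
move=> n0 lam0 minb eE YE.
have nn0 : n%:R != 0 :> R by rewrite pnatr_eq0 -lt0n.
pose A i := e (x i) - Pn x e; pose D i := Y (x i) - Pn x Y.
have PnY : Pn x Y = \sum_(j < m) (b j - bs j) * Pn x (h j).
  rewrite (funext YE) Pn_sum; apply: eq_bigr => j _; exact: PnZ.
have Pne : Pn x e = Pn x f - c - \sum_(j < m) bs j * Pn x (h j).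
  have -> : e = (fun t => f t + (- c + (-1) * \sum_(j < m) bs j * h j t)).
    by apply/funext => t; rewrite eE; ring.
  rewrite PnD PnD PnZ Pn_cst// Pn_sum.
  under eq_bigr do rewrite PnZ.
  ring.
(* Along the segment the centered residual is affine in the step: [A] is the centered noise, [D] the
   centered prediction error, and [c] drops out. *)
have res th i : (f (x i) - Pn x f) -
    \sum_(j < m) (h j (x i) - Pn x (h j)) * (b j - th * (b j - bs j)) = A i - (1 - th) * D i.
  rewrite /A /D eE YE Pne PnY.
  have -> : \sum_(j < m) (h j (x i) - Pn x (h j)) * (b j - th * (b j - bs j)) =
    (\sum_(j < m) bs j * h j (x i) - \sum_(j < m) bs j * Pn x (h j)) +
    (1 - th) * (\sum_(j < m) (b j - bs j) * h j (x i) - \sum_(j < m) (b j - bs j) * Pn x (h j)).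
    rewrite -!sumrB mulr_sumr -big_split/=; apply: eq_bigr => j _; ring.
  ring.
pose S1 := \sum_(i < n) A i * D i; pose S2 := \sum_(i < n) D i ^+ 2.
pose SA := \sum_(i < n) A i ^+ 2.
have sumsq th : \sum_(i < n) (A i - (1 - th) * D i) ^+ 2 =
    SA - 2 * (1 - th) * S1 + (1 - th) ^+ 2 * S2.
  rewrite /SA /S1 /S2 !mulr_sumr -sumrB -big_split/=.
  by apply: eq_bigr => i _; ring.
set B1 := \sum_(j < m) `|b j|; set BS := \sum_(j < m) `|bs j|.
have objE th : lasso_obj x f h lam (fun j => b j - th * (b j - bs j)) =
    (2 * n%:R)^-1 * (SA - 2 * (1 - th) * S1 + (1 - th) ^+ 2 * S2)
    + lam * \sum_(j < m) `|b j - th * (b j - bs j)|.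
  rewrite /lasso_obj -sumsq; congr (_ * _ + _).
  by apply: eq_bigr => i _; rewrite res.
have key th : 0 < th <= 1 -> 0 <= (S1 - S2 + th * S2 / 2) / n%:R + lam * (BS - B1).
  move=> /andP[th0 th1].
  have := minb (fun j => b j - th * (b j - bs j)).
  have -> : lasso_obj x f h lam b = lasso_obj x f h lam (fun j => b j - 0 * (b j - bs j)).
    by congr lasso_obj; apply/funext => j; rewrite mul0r subr0.
  rewrite !objE.
  have -> : \sum_(j < m) `|b j - 0 * (b j - bs j)| = B1.
    by apply: eq_bigr => j _; rewrite mul0r subr0.
  have l1 : \sum_(j < m) `|b j - th * (b j - bs j)| <= (1 - th) * B1 + th * BS.
    rewrite /B1 /BS !mulr_sumr -big_split/=; apply: ler_sum => j _.
    rewrite (_ : b j - th * (b j - bs j) = (1 - th) * b j + th * bs j); last by ring.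
    by rewrite (le_trans (ler_normD _ _))// !normrM (gtr0_norm th0) ger0_norm// subr_ge0.
  have := ler_wpM2l lam0 l1 => l2 l3.
  have l4 := le_trans l3 (lerD (lexx _) l2).
  rewrite -(pmulr_rge0 _ th0); have l5 := l4; rewrite -subr_ge0 in l5.
  apply: (le_trans l5); rewrite le_eqVlt; apply/orP; left; apply/eqP; field.
  by rewrite nn0.
have S20 : 0 <= S2 by rewrite sumr_ge0// => i _; exact: sqr_ge0.
have n1 : 0 < n%:R :> R by rewrite ltr0n.
have fin : 0 <= (S1 - S2) / n%:R + lam * (BS - B1).
  rewrite leNgt; apply/negP => neg.
  set eta := - ((S1 - S2) / n%:R + lam * (BS - B1)).
  have eta0 : 0 < eta by rewrite /eta; lra.
  set v := S2 / n%:R; have v0 : 0 <= v by rewrite /v divr_ge0// ltW.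
  (* Small enough for the remainder [th * v / 2] to stay below the gap [eta]; [1 + v] avoids a zero
     denominator. *)
  set th := Num.min 1 (eta / (1 + v)).
  have th0 : 0 < th by rewrite /th lt_min ltr01 divr_gt0//; lra.
  have th1 : th <= 1 by rewrite /th ge_min lexx.
  have := key th; rewrite th0 th1 => /(_ isT).
  have th2 : th * (1 + v) <= eta by rewrite -ler_pdivlMr ?ge_min ?lexx ?orbT//; lra.
  rewrite (_ : (S1 - S2 + th * S2 / 2) / n%:R + _ = - eta + th * v / 2); last first.
    by rewrite /eta /v; field.
  have := mulr_ge0 (ltW th0) v0; lra.
have -> : Pn x (fun t => (Y t - Pn x Y) ^+ 2) = S2 / n%:R by rewrite /Pn mulrC.
have -> : Pn x (fun t => e t * (Y t - Pn x Y)) = S1 / n%:R.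
  rewrite /Pn mulrC; congr (_ / _).
  have sD : \sum_(i < n) D i = 0.
    by rewrite /D sumrB sumr_const card_ord -[_ *+ n]mulr_natl /Pn mulrA divff// mul1r subrr.
  have -> : S1 = \sum_(i < n) e (x i) * D i - Pn x e * \sum_(i < n) D i.
    by rewrite /S1 mulr_sumr -sumrB; apply: eq_bigr => i _; rewrite /A mulrBl.
  by rewrite sD mulr0 subr0.
move: fin; rewrite mulrBl; lra.
Qed.

(** Off the support [bs] vanishes, so [b] and the difference agree there; on it the triangle
    inequality applies. *)
Lemma l1_norm_gap (b bs : 'I_m -> R) :
  \sum_(j in ~: supp bs) `|b j - bs j| - \sum_(j in supp bs) `|b j - bs j|
  <= \sum_(j < m) `|b j| - \sum_(j < m) `|bs j|.
Proof.
have split (g : 'I_m -> R) :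
    \sum_(j < m) g j = \sum_(j in supp bs) g j + \sum_(j in ~: supp bs) g j.
  rewrite (bigID (mem (supp bs)))/=; congr (_ + _).
  by apply: eq_bigl => j; rewrite finset.in_setC.
rewrite (split (fun j => `|b j|)) (split (fun j => `|bs j|)).
have z : \sum_(j in ~: supp bs) `|bs j| = 0.
  by apply: big1 => j; rewrite !inE negbK => /eqP ->; rewrite normr0.
have zz : \sum_(j in ~: supp bs) `|b j - bs j| = \sum_(j in ~: supp bs) `|b j|.
  by apply: eq_bigr => j; rewrite !inE negbK => /eqP ->; rewrite subr0.
have : \sum_(j in supp bs) `|bs j| <=
    \sum_(j in supp bs) `|b j| + \sum_(j in supp bs) `|b j - bs j|.
  rewrite -big_split/=; apply: ler_sum => j _.
  by have := ler_normB (b j) (b j - bs j); rewrite opprB addrCA subrr addr0.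
rewrite z zz; lra.
Qed.
End lasso.

(* Here [a] is the proportion of the l1 error carried by the support, so that the penalty gains
   [lam * r * (1 - 2 * a)]; [p2] and [mu] stand for the empirical and true second moments of [y]. *)
Lemma l1_error_contradiction (R : realType) (M : nat)
    (a r lam U tau gamma ell L L2 n xi S2 nu q mu p2 s b N V : R) :
  0 < r -> 0 < lam -> 0 < U -> 0 < tau -> 0 < gamma -> 0 < ell -> 0 < L -> 0 < n ->
  xi = ell * U ^+ 2 / gamma -> N = n / (xi * L) -> V = Num.max N (16 * xi) ->
  128 * xi * L <= n -> 8 * xi ^+ 2 * L2 <= n -> L <= L2 ->
  49 * U ^+ 2 * tau ^+ 2 * L / n <= lam ^+ 2 ->
  b <= M%:R * L -> b <= M%:R * L2 / 2 -> 0 <= b -> 0 < s -> 0 <= S2 ->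
  (forall a N : R, 128 <= N -> N <= V -> V <= 2 * N ->
    1 - 2 * a <= 311/1000 -> 1 - 2 * a <= N * (5 / (4 * 4 * 48 * 49)) ->
    M%:R / V + kern_offset M s * (V / 16)
      + kern_slope s * ((2 * a - 689/1000) / 48 + 2 / N) < s * a ^+ 2) ->
  0 <= kern_offset M s ->
  S2 + lam * r * (1 - 2 * a) <= nu ->
  nu <= 311/1000 * (lam * r) ->
  nu ^+ 2 <= 5 / 4 * tau ^+ 2 * S2 ->
  p2 * (r ^+ 2 * U ^+ 2) = S2 + q -> q <= 2 * L / n * (r ^+ 2 * U ^+ 2) ->
  a ^+ 2 / xi <= mu ->
  s * mu <= kern_offset M s + kern_slope s * p2 + b / n ->
  r <= 48 * lam * ell / gamma.
Proof.
move=> r0 lam0 U0 tau0 g0 ell0 L0 n0 xiE NE VE n1 n2 LL2 lam2 b1 b2 b0 s0 S20 K c00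
  H1 H2 H3 H4 H5 H6 H7.
rewrite leNgt; apply/negP => rbig.
have xi0 : 0 < xi by rewrite xiE divr_gt0// mulr_gt0// exprn_gt0.
have xL0 : 0 < xi * L by exact: mulr_gt0.
have N128 : 128 <= N by rewrite NE ler_pdivlMr// mulrA.
have N0 : 0 < N by clear -N128; lra.
have NV : N <= V by rewrite VE le_max lexx.
have V0 : 0 < V by clear -N0 NV; lra.
have V16 : 16 * xi <= V by rewrite VE le_max lexx orbT.
have x8 : 8 * xi <= N.
  rewrite NE ler_pdivlMr//; apply: le_trans n2.
  have : 8 * xi ^+ 2 * L <= 8 * xi ^+ 2 * L2.
    by rewrite ler_wpM2l// mulr_ge0// sqr_ge0.
  by apply: le_trans; rewrite expr2; clear; lra.
have V2N : V <= 2 * N by rewrite VE ge_max; apply/andP; split; clear -N0 x8; lra.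
have lr0 : 0 < lam * r by exact: mulr_gt0.
have za : 1 - 2 * a <= 311/1000.
  have : lam * r * (1 - 2 * a) <= lam * r * (311/1000) by clear -H1 H2 S20; lra.
  by rewrite ler_pM2l.
have rU : 48 * lam * xi <= r * U ^+ 2.
  rewrite xiE; have := ltW rbig; move=> /(ler_wpM2r (sqr_ge0 U)).
  by apply: le_trans; rewrite le_eqVlt; apply/orP; left; apply/eqP; field; rewrite gt_eqF.
(* Eliminating [S2] and maximising [nu - 4 * nu^2 / (5 * tau^2)] gives
   [lam * r * (1 - 2 * a) <= 5 * tau^2 / 16]. The assumed size of [r] and the lower bound on [lam]
   give [lam * r * N >= 48 * 49 * tau^2]. *)
have zN : 1 - 2 * a <= N * (5 / (4 * 4 * 48 * 49)).
  have h1 : lam * r * (1 - 2 * a) <= 5 * tau ^+ 2 / 16.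
    have h2 : nu ^+ 2 * 4 <= 5 * tau ^+ 2 * S2 by clear -H3; lra.
    have t0 : 0 < 5 * tau ^+ 2 by rewrite mulr_gt0// exprn_gt0.
    rewrite -(ler_pM2l t0).
    have := sqr_ge0 (8 * nu - 5 * tau ^+ 2).
    have : 5 * tau ^+ 2 * (S2 + lam * r * (1 - 2 * a)) <= 5 * tau ^+ 2 * nu.
      by rewrite ler_pM2l.
    by clear -h2; lra.
  have h3 : 48 * 49 * tau ^+ 2 <= lam * r * N.
    have U2 : 0 < U ^+ 2 by rewrite exprn_gt0.
    rewrite -(ler_pM2r U2).
    have i1 : 48 * lam ^+ 2 * xi * N <= lam * r * N * U ^+ 2.
      rewrite (_ : 48 * _ * _ * _ = lam * N * (48 * lam * xi)); last by ring.
      rewrite (_ : lam * r * N * _ = lam * N * (r * U ^+ 2)); last by ring.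
      by rewrite ler_wpM2l// ltW// mulr_gt0.
    apply: le_trans i1.
    have xN : 0 < 48 * xi * N by rewrite !mulr_gt0.
    have := ler_wpM2l (ltW xN) lam2.
    rewrite (_ : 48 * xi * N * lam ^+ 2 = 48 * lam ^+ 2 * xi * N); last by ring.
    apply: le_trans; rewrite le_eqVlt; apply/orP; left; apply/eqP.
    by rewrite NE; field; rewrite !gt_eqF.
  have [z0|z0] := leP (1 - 2 * a) 0.
    by apply: (le_trans z0); rewrite mulr_ge0 ?(ltW N0)// divr_ge0.
  have t0 : 0 < tau ^+ 2 by rewrite exprn_gt0.
  rewrite -(ler_pM2l (_ : 0 < 48 * 49 * tau ^+ 2)); last by rewrite mulr_gt0.
  have := ler_wpM2r (ltW z0) h3.
  have := ler_wpM2r (ltW N0) h1.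
  by clear; lra.
have := K a N N128 NV V2N za zN; apply/negP; rewrite -leNgt.
have iV : 0 < V^-1 by rewrite invr_gt0.
have a1 : s * a ^+ 2 <= xi * (s * mu).
  rewrite [leRHS]mulrCA ler_pM2l//; move: H6; rewrite ler_pdivrMr// mulrC.
  by [].
apply: (le_trans a1).
(* The two bounds on [b] match the two terms of the maximum: [M * L] gives M/N, and [M * L2 / 2]
   with [8 * xi^2 * L2 <= n] gives M/(16 xi). *)
have a2 : xi * (b / n) <= M%:R / V.
  rewrite VE; case: (leP N (16 * xi)) => _.
    have xi16 : 0 < 16 * xi by clear -xi0; lra.
    rewrite mulrA ler_pdivrMr// mulrAC ler_pdivlMr//.
    have h1 : xi * b * (16 * xi) <= xi * (M%:R * L2 / 2) * (16 * xi).
      by rewrite ler_pM2r// ler_pM2l.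
    apply: (le_trans h1).
    have := ler_wpM2l (ler0n R M) n2.
    by rewrite expr2; clear; lra.
  rewrite NE invf_div mulrA ler_pdivrMr// mulrA divfK ?gt_eqF//.
  by rewrite mulrCA ler_wpM2l// ltW.
have a3 : xi * kern_offset M s <= kern_offset M s * (V / 16).
  by rewrite mulrC ler_wpM2l//; clear -V16; lra.
have rU0 : 0 < r ^+ 2 * U ^+ 2 by rewrite mulr_gt0// exprn_gt0.
(* Here 689/1000 = 1 - 311/1000. The first term is [S2] divided using [r * U^2 >= 48 * lam * xi],
   the second is the centering correction [q]. *)
have a4 : xi * p2 <= (2 * a - 689/1000) / 48 + 2 / N.
  rewrite -(ler_pM2r rU0) -mulrA H4.
  have h1 : S2 <= lam * r * (2 * a - 689/1000) by clear -H1 H2; lra.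
  have e0 : 0 <= 2 * a - 689/1000 by clear -za; lra.
  have h2 : xi * S2 <= (2 * a - 689 / 1000) / 48 * (r ^+ 2 * U ^+ 2).
    have := ler_wpM2l (ltW xi0) h1 => /le_trans; apply.
    have := ler_wpM2l (mulr_ge0 (ltW r0) e0) rU; rewrite expr2; clear; lra.
  have h3 : xi * q <= 2 / N * (r ^+ 2 * U ^+ 2).
    have := ler_wpM2l (ltW xi0) H5 => /le_trans; apply.
    rewrite le_eqVlt; apply/orP; left; apply/eqP.
    by rewrite NE; field; rewrite !gt_eqF.
  by rewrite mulrDr [leRHS]mulrDl; clear -h2 h3; lra.
have G0 : 0 <= kern_slope s.
  rewrite /kern_slope; have := exprn_gt0 2 s0; have := exprn_gt0 3 s0; clear -s0; lra.
have := ler_wpM2l (ltW xi0) H7.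
have := ler_wpM2l G0 a4.
by clear -a2 a3; lra.
Qed.

(** * Union and Chernoff bounds *)

Section deviation.
Context {R : realType} {d d' : measure_display} {T : measurableType d}
  {Omega : measurableType d'} (P : probability T R) (Q : probability Omega R).

Lemma union_bound (I : finType) (B : I -> set Omega) (c : I -> R) :
  (forall i, measurable (B i)) -> (forall i, (Q (B i) <= (c i)%:E)%E) ->
  exists A : set Omega, [/\ measurable A, (Q A <= (\sum_i c i)%:E)%E &
    forall w, ~ A w -> forall i, ~ B i w].
Proof.
move=> mB QB; exists (\big[setU/set0]_i B i); split.
- exact: bigsetU_measurable.
- rewrite -sumEFin.
  elim: (index_enum I) => [|i s IH]; first by rewrite !big_nil measure0.
  have ms : measurable (\big[setU/set0]_(j <- s) B j) by exact: bigsetU_measurable.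
  rewrite !big_cons; apply: (le_trans (measureU2 Q (mB i) ms)).
  apply: leeD; [exact: QB|exact: IH].
move=> w nA i Bi; apply: nA.
by rewrite -bigcup_seq; exists i => //=; rewrite mem_index_enum.
Qed.

(** Chernoff's bound at the optimal exponents [t / v] and [- t / v], indexed by a boolean; for them
    [a + n * l^2 * v / 2] equals [|l| * n * t]. *)
Lemma subgaussian_deviation n (X : 'I_n -> Omega -> T) (g : T -> R) (v a : R) :
  iid_sample Q P X -> (0 < n)%N -> measurable_fun setT g -> 0 < v -> 0 < a ->
  (forall l : R, \int[P]_x (expR (l * g x))%:E <= (expR (l ^+ 2 * v / 2))%:E)%E ->
  exists B : set Omega, [/\ measurable B, (Q B <= (2 * expR (- a))%:E)%E &
    forall w, ~ B w -> `|Pn (X^~ w) g| <= Num.sqrt (2 * v * a / n%:R)].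
Proof.
move=> iid n0 mg v0 a0 mgf.
have nn : 0 < n%:R :> R by rewrite ltr0n.
pose t := Num.sqrt (2 * v * a / n%:R).
have t0 : 0 < t by rewrite sqrtr_gt0 divr_gt0// !mulr_gt0.
have t2 : t ^+ 2 = 2 * v * a / n%:R by rewrite sqr_sqrtr// ltW// divr_gt0// !mulr_gt0.
pose l (e : bool) : R := (if e then 1 else -1) * (t / v).
have l2 e : l e ^+ 2 = (t / v) ^+ 2 by rewrite /l; case: e; ring.
pose K := expR ((t / v) ^+ 2 * v / 2).
pose B e := [set w | expR a * K ^+ n <= \prod_(i < n) expR (l e * g (X i w))].
have me e : measurable_fun setT (fun x => expR (l e * g x)).
  by apply: measurableT_comp => //; exact: measurable_funM.
have mB e : measurable (B e) by exact: measurable_iid_prod_ge iid (me e).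
have QB e : (Q (B e) <= (expR (- a))%:E)%E.
  have := iid_markov (K := K) (t := expR a * K ^+ n) iid (me e) (fun x => expR_ge0 _).
  have := mgf (l e); rewrite l2 => h /(_ h).
  rewrite mulr_gt0 ?expR_gt0 ?exprn_gt0 ?expR_gt0// => /(_ isT).
  rewrite invfM mulrCA divff ?mulr1 ?expRN//.
  by rewrite gt_eqF// exprn_gt0// expR_gt0.
have [A [mA QA nA]] := union_bound mB QB.
exists A; split => //.
  by rewrite (le_trans QA)// lee_fin big_bool/=; lra.
move=> w /nA nB.
have up e : l e * \sum_(i < n) g (X i w) <= a + n%:R * ((t / v) ^+ 2 * v / 2).
  have := nB e; rewrite /B/= => /negP; rewrite -ltNge => /ltW.
  rewrite -expR_sum -mulr_sumr /K -expRM_natl -expRD ler_expR.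
  by apply.
have E : a + n%:R * ((t / v) ^+ 2 * v / 2) = (t / v) * (n%:R * t).
  have -> : a = t ^+ 2 * n%:R / (2 * v).
    by rewrite t2; field; rewrite !gt_eqF.
  by field; rewrite gt_eqF.
have tv : 0 < t / v by rewrite divr_gt0.
have := up true; have := up false; rewrite E /l mul1r mulN1r mulNr.
rewrite ler_pM2l// => h1; rewrite -mulrN ler_pM2l// in h1 *.
move=> h2; rewrite /Pn -/t ler_norml; apply/andP; split.
  by rewrite -(ler_pM2l nn) mulrA divff ?gt_eqF// mul1r; lra.
by rewrite -(ler_pM2l nn) mulrA divff ?gt_eqF// mul1r.
Qed.
End deviation.

Lemma normrM_le_sqrD (R : realFieldType) (a b : R) : `|a * b| <= a ^+ 2 + b ^+ 2.
Proof.
rewrite ler_norml; have := sqr_ge0 (a - b); have := sqr_ge0 (a + b).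
have := sqr_ge0 a; have := sqr_ge0 b; lra.
Qed.

Section orthogonality.
Context {R : realType} {d : measure_display} {T : measurableType d}
  (P : probability T R).

(** Minimality says [- 2 * t * A + t^2 * H >= 0] for all [t]. The choice [t = A / (H + 1)] also
    covers [H = 0] and forces [A = 0]. *)
Lemma square_minimizer_orthogonal (e h : T -> R) (U : R) :
  measurable_fun setT e -> measurable_fun setT h ->
  P.-integrable setT (fun x => (e x ^+ 2)%:E) -> (forall x, `|h x| <= U) ->
  (forall t : R, \int[P]_x (e x ^+ 2)%:E <= \int[P]_x ((e x - t * h x) ^+ 2)%:E)%E ->
  P.-integrable setT (EFin \o (fun x => h x * e x)) /\
  PE P (fun x => h x * e x) = 0.
Proof.
move=> me mh ie2 hU emin.
have bh : bounded_measurable h by split => //; exists U.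
have ih2 : P.-integrable setT (EFin \o (fun x => h x ^+ 2)).
  exact: (bounded_measurable_integrable P (bounded_measurableM bh bh)).
have i1 : P.-integrable setT (EFin \o (cst 1 : T -> R)).
  exact: (bounded_measurable_integrable P (bounded_measurable_cst _)).
have ihe : P.-integrable setT (EFin \o (fun x => h x * e x)).
  apply: (@le_integrable _ _ _ P setT measurableT _ (EFin \o (fun x => h x ^+ 2 + e x ^+ 2))).
  - by apply/measurable_EFinP; exact: measurable_funM.
  - move=> x _ /=; rewrite lee_fin [leRHS]ger0_norm ?addr_ge0 ?sqr_ge0//.
    exact: normrM_le_sqrD.
  - exact: (integrableD measurableT ih2 ie2).
split => //.
set A := PE P _; set H := PE P (fun x => h x ^+ 2); set C := PE P (fun x => e x ^+ 2).
have quad t : C <= C + ((- 2 * t) * A + t ^+ 2 * H).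
  have j1 : P.-integrable setT (EFin \o (fun x => (- 2 * t) * (h x * e x))).
    rewrite (_ : EFin \o _ = (fun x => ((- 2 * t)%:E * (h x * e x)%R%:E)%E)).
      exact: integrableZl.
    by apply/funext => x; rewrite /= EFinM.
  have j2 : P.-integrable setT (EFin \o (fun x => t ^+ 2 * h x ^+ 2)).
    rewrite (_ : EFin \o _ = (fun x => ((t ^+ 2)%:E * (h x ^+ 2)%R%:E)%E)).
      exact: integrableZl.
    by apply/funext => x; rewrite /= EFinM.
  have j3 : P.-integrable setT (EFin \o (fun x => (- 2 * t) * (h x * e x) + t ^+ 2 * h x ^+ 2)).
    exact: (integrableD measurableT j1 j2).
  have j4 : P.-integrable setT (EFin \o (fun x => e x ^+ 2 +
      ((- 2 * t) * (h x * e x) + t ^+ 2 * h x ^+ 2))).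
    exact: (integrableD measurableT ie2 j3).
  have -> : C + ((- 2 * t) * A + t ^+ 2 * H) = PE P (fun x => e x ^+ 2 +
      ((- 2 * t) * (h x * e x) + t ^+ 2 * h x ^+ 2)).
    by rewrite /PE RintegralD// RintegralD// RintegralZl// RintegralZl.
  rewrite -lee_fin /C /PE /Rintegral !fineK; last 2 first.
  - exact: integrable_fin_num.
  - exact: integrable_fin_num.
  apply: (le_trans (emin t)); rewrite le_eqVlt; apply/orP; left; apply/eqP.
  by apply: eq_integral => x _; congr (_%:E); ring.
have H0 : 0 <= H by apply: Rintegral_ge0 => x _; exact: sqr_ge0.
have := quad (A / (H + 1)).
have H1 : 0 < H + 1 by lra.
rewrite lerDl (_ : _ + _ = - (A ^+ 2 * (H + 2) / (H + 1) ^+ 2)); last first.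
  by field; rewrite gt_eqF.
rewrite oppr_ge0 pmulr_lle0 ?invr_gt0 ?exprn_gt0// pmulr_lle0; last lra.
by move=> A2; apply/eqP; rewrite -sqrf_eq0 eq_le A2 sqr_ge0.
Qed.
End orthogonality.

(** Cauchy-Schwarz, as nonnegativity of the variance of the moduli over [A]. *)
Lemma sqr_sum_norm_le (R : realFieldType) (I : finType) (A : {set I}) (u : I -> R) :
  (\sum_(j in A) `|u j|) ^+ 2 <= #|A|%:R * \sum_(j in A) u j ^+ 2.
Proof.
set r := \sum_(j in A) `|u j|; set l : R := #|A|%:R.
have [l0|l0] := eqVneq l 0.
  have A0 : A = finset.set0.
    by apply: cards0_eq; apply/eqP; rewrite -(eqr_nat R); apply/eqP.
  by rewrite /r A0 !big_set0 expr0n/= mulr0.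
have lp : 0 < l by rewrite lt_def l0 ler0n.
have : 0 <= \sum_(j in A) (`|u j| - r / l) ^+ 2 by apply: sumr_ge0 => j _; exact: sqr_ge0.
have -> : \sum_(j in A) (`|u j| - r / l) ^+ 2 =
    \sum_(j in A) u j ^+ 2 - r ^+ 2 / l.
  transitivity (\sum_(j in A) (u j ^+ 2 + (- 2 * r / l) * `|u j| + (r / l) ^+ 2)).
    apply: eq_bigr => j _; rewrite -(real_normK (num_real (u j))); ring.
  rewrite !big_split/= sumr_const -mulr_sumr -/r -[_ *+ #|A|]mulr_natl -/l.
  by field.
by rewrite subr_ge0 ler_pdivrMr// mulrC.
Qed.

Lemma le_of_sqr_le_inv128 (R : realFieldType) (z : R) :
  0 <= z -> z ^+ 2 <= 128^-1 -> z <= 177/2000.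
Proof.
move=> z0 z2; rewrite leNgt; apply/negP => h.
have : 0 < (z - 177/2000) * (z + 177/2000) by rewrite mulr_gt0; lra.
lra.
Qed.

(** * The l1 error on the deviation events *)

Section lasso_error.
Context {R : realType} {d : measure_display} {T : measurableType d}
  (P : probability T R) {m n : nat} (x : 'I_n -> T).
Variables (f : T -> R) (h : 'I_m -> T -> R) (bs : 'I_m -> R) (c : R) (e : T -> R).
Variables (U tau gamma lam L L2 L1 b s : R) (M : nat).
Hypothesis n0 : (0 < n)%N.
Hypothesis mh : forall j, measurable_fun setT (h j).
Hypothesis hU : forall j t, `|h j t| <= U.
Hypotheses (U0 : 0 < U) (tau0 : 0 < tau) (gamma0 : 0 < gamma) (L0 : 0 < L).
Hypotheses (L1L : L1 <= L) (LL2 : L <= L2).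
Hypothesis eE : forall t, e t = f t - c - \sum_(j < m) bs j * h j t.
Hypothesis S0 : (0 < #|supp bs|)%N.
Hypothesis RE : forall u : 'I_m -> R, cone (supp bs) 3 u ->
  gamma * \sum_(j < m) u j ^+ 2 <= \sum_(j < m) \sum_(k < m) u j * Gram P h j k * u k.

Let ell : R := #|supp bs|%:R.
Let xi := ell * U ^+ 2 / gamma.
Let V := Num.max (n%:R / (xi * L)) (16 * xi).

Hypothesis n1 : 128 * xi * L <= n%:R.
Hypothesis n2 : 8 * xi ^+ 2 * L2 <= n%:R.
Hypothesis xi1 : 1 <= xi.
Hypothesis lamL : 7 * U * tau * Num.sqrt (L / n%:R) <= lam.
Hypotheses (M12 : (12 <= M)%N) (s01 : 0 < s <= 7/10).
Hypothesis K : forall a N : R, 128 <= N -> N <= V -> V <= 2 * N ->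
    1 - 2 * a <= 311/1000 -> 1 - 2 * a <= N * (5 / (4 * 4 * 48 * 49)) ->
    M%:R / V + kern_offset M s * (V / 16)
      + kern_slope s * ((2 * a - 689/1000) / 48 + 2 / N) < s * a ^+ 2.
Hypotheses (b0 : 0 <= b) (b1 : b <= M%:R * L) (b2 : b <= M%:R * L2 / 2).

Let signed (j : 'I_m * bool) (t : T) : R := (-1) ^+ j.2 * h j.1 t / U.

Hypothesis E1 : `|Pn x e| <= Num.sqrt (2 * tau ^+ 2 * L1 / n%:R).
Hypothesis E2 : forall j, `|Pn x (h j)| <= Num.sqrt (2 * U ^+ 2 * L / n%:R).
Hypothesis E3 : forall j,
  `|Pn x (fun t => h j t * e t)| <= Num.sqrt (2 * (2 * (U ^+ 2 * tau ^+ 2)) * L / n%:R).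
Hypothesis E4 : Pn x (fun t => e t ^+ 2) <= 5 / 4 * tau ^+ 2.
Hypothesis E5 : forall l : seq ('I_m * bool), size l = M ->
    \sum_(i < n) ln (sgnE (map (signed^~ (x i)) l) (kern M s) 0) <=
    n%:R * (PE P (fun t => sgnE (map (signed^~ t) l) (kern M s) 0) - 1) + b.

Lemma bounded_measurable_h j : bounded_measurable (h j).
Proof. by split => //; exists U. Qed.

Lemma PE_sqr_lincomb (u : 'I_m -> R) :
  PE P (fun t => (\sum_(j < m) u j * h j t) ^+ 2) =
  \sum_(j < m) \sum_(k < m) u j * Gram P h j k * u k.
Proof.
have bb j k : bounded_measurable (fun t => h j t * h k t).
  by apply: bounded_measurableM; exact: bounded_measurable_h.
have -> : (fun t => (\sum_(j < m) u j * h j t) ^+ 2) =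
    (fun t => \sum_(j < m) u j * (\sum_(k < m) u k * (h j t * h k t))).
  apply/funext => t; rewrite expr2 big_distrl/=; apply: eq_bigr => j _.
  by rewrite -mulrA mulr_sumr; congr (_ * _); apply: eq_bigr => k _; ring.
rewrite PE_sum; last first.
  by move=> j; apply: bounded_measurable_sum => k; exact: bounded_measurableZ.
apply: eq_bigr => j _; rewrite PE_sum//.
by rewrite mulr_sumr; apply: eq_bigr => k _; rewrite /Gram; ring.
Qed.

Let nn : 0 < n%:R :> R. Proof. by rewrite ltr0n. Qed.
Let sg := Num.sqrt (L / n%:R).
Let sg0 : 0 < sg. Proof. by rewrite sqrtr_gt0 divr_gt0. Qed.
Let sg2 : sg ^+ 2 = L / n%:R. Proof. by rewrite sqr_sqrtr// ltW// divr_gt0. Qed.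

Lemma sqrt_scale (k q : R) : 0 <= k -> Num.sqrt (k ^+ 2 * L / n%:R) = k * sg.
Proof. by move=> k0; rewrite -mulrA sqrtrM ?sqr_ge0// sqrtr_sqr ger0_norm. Qed.

(** With [sg] = sqrt(L/n) <= 177/2000, just above 128^(-1/2), the two terms add up to at most (2 + 2
    * 177/2000) U tau [sg], and 2.177/7 = 311/1000. *)
Lemma noise_bound j :
  `|Pn x (fun t => h j t * e t) - Pn x (h j) * Pn x e| <= 311/1000 * lam.
Proof.
have lL : n%:R >= 128 * L.
  apply: le_trans n1; rewrite -[leRHS]mulrA; apply: ler_wpM2l => //.
  by apply: ler_peMl => //; exact: ltW.
have s2 : sg ^+ 2 <= 128^-1.
  by rewrite sg2 ler_pdivrMr//; lra.
have s1 : sg <= 177/2000.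
  exact: le_of_sqr_le_inv128 (ltW sg0) s2.
have e3 : `|Pn x (fun t => h j t * e t)| <= 2 * (U * tau) * sg.
  rewrite -(@sqrt_scale (2 * (U * tau)) 0); last by rewrite !mulr_ge0// ltW.
  rewrite (_ : (2 * (U * tau)) ^+ 2 = 2 * (2 * (U ^+ 2 * tau ^+ 2))); last by ring.
  exact: E3.
have r2 : 0 <= Num.sqrt 2 :> R by rewrite sqrtr_ge0.
have r22 : Num.sqrt 2 ^+ 2 = 2 :> R by rewrite sqr_sqrtr.
have e2 : `|Pn x (h j)| <= Num.sqrt 2 * U * sg.
  rewrite -(@sqrt_scale (Num.sqrt 2 * U) 0); last by rewrite mulr_ge0// ltW.
  by rewrite exprMn r22; exact: E2.
have e1 : `|Pn x e| <= Num.sqrt 2 * tau * sg.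
  rewrite -(@sqrt_scale (Num.sqrt 2 * tau) 0); last by rewrite mulr_ge0// ltW.
  rewrite exprMn r22; apply: (le_trans E1); rewrite ler_sqrt.
    rewrite ler_pM2r ?invr_gt0// ler_wpM2l// mulr_ge0// sqr_ge0//.
  by rewrite divr_ge0 ?(ltW nn)// !mulr_ge0 ?sqr_ge0// ltW.
have e12 : `|Pn x (h j) * Pn x e| <= 2 * (U * tau) * sg * sg.
  rewrite normrM; apply: (le_trans (ler_pM _ _ e2 e1)) => //.
  rewrite (_ : 2 * (U * tau) * sg * sg = Num.sqrt 2 ^+ 2 * (U * tau) * sg * sg).
    by rewrite le_eqVlt; apply/orP; left; apply/eqP; ring.
  by rewrite r22.
apply: (le_trans (ler_normB _ _)); apply: (le_trans (lerD e3 e12)).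
have Ut0 : 0 < U * tau * sg by rewrite !mulr_gt0.
have h1 : U * tau * sg * sg <= U * tau * sg * (177/2000) by rewrite ler_pM2l.
have h2 : 7 * (U * tau * sg) <= lam.
  by apply: le_trans lamL; rewrite -/sg !mulrA.
lra.
Qed.

Variable bhat : 'I_m -> R.
Hypothesis min : lasso_minimizer x f h lam bhat.

Let u j := bhat j - bs j.
Let Y t := \sum_(j < m) u j * h j t.
Let r := \sum_(j < m) `|u j|.

Lemma Pn_lincomb_le : `|Pn x Y| <= r * (Num.sqrt 2 * U * sg).
Proof.
have -> : Pn x Y = \sum_(j < m) u j * Pn x (h j).
  by rewrite /Y Pn_sum; apply: eq_bigr => j _; exact: PnZ.
apply: (le_trans (ler_norm_sum _ _ _)).
rewrite /r mulr_suml; apply: ler_sum => j _.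
rewrite normrM ler_wpM2l//.
rewrite -(@sqrt_scale (Num.sqrt 2 * U) 0); last by rewrite mulr_ge0 ?sqrtr_ge0// ltW.
by rewrite exprMn sqr_sqrtr.
Qed.

Lemma lasso_l1_error : r <= 48 * lam * ell / gamma.
Proof.
have ell0 : 0 < ell by rewrite ltr0n.
have lam0 : 0 < lam.
  by apply: lt_le_trans lamL; rewrite !mulr_gt0.
have xi0 : 0 < xi by apply: lt_le_trans xi1.
have [r0|r0] := leP r 0.
  by apply: (le_trans r0); rewrite divr_ge0 ?(ltW gamma0)// !mulr_ge0 ?(ltW lam0)// ltW.
pose rS := \sum_(j in supp bs) `|u j|.
pose rC := \sum_(j in ~: supp bs) `|u j|.
have rE : r = rS + rC.
  rewrite /r /rS /rC (bigID (mem (supp bs)))/=; congr (_ + _).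
  by apply: eq_bigl => j; rewrite finset.in_setC.
pose a := rS / r.
have aE : r * (1 - 2 * a) = rC - rS.
  by rewrite /a rE; field; rewrite -rE gt_eqF.
have rS0 : 0 <= rS by apply: sumr_ge0.
pose S2 := Pn x (fun t => (Y t - Pn x Y) ^+ 2).
have S20 : 0 <= S2.
  by rewrite /S2 /Pn mulr_ge0 ?invr_ge0// sumr_ge0// => i _; exact: sqr_ge0.
pose nu := Pn x (fun t => e t * (Y t - Pn x Y)).
have H1 : S2 + lam * r * (1 - 2 * a) <= nu.
  have := lasso_three_point n0 (ltW lam0) min eE (fun t => erefl (Y t)).
  apply: le_trans; rewrite -mulrA aE lerD2l ler_pM2l//.
  exact: l1_norm_gap.
have H2 : nu <= 311/1000 * (lam * r).
  have -> : nu = \sum_(j < m) u j * (Pn x (fun t => h j t * e t) - Pn x (h j) * Pn x e).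
    have -> : nu = Pn x (fun t => e t * Y t) + (- Pn x Y) * Pn x e.
      by rewrite -PnZ -PnD; congr Pn; apply/funext => t; ring.
    have -> : Pn x (fun t => e t * Y t) = \sum_(j < m) u j * Pn x (fun t => h j t * e t).
      rewrite -(eq_bigr _ (fun j _ => PnZ x (u j) (fun t => h j t * e t))) -Pn_sum.
      by congr Pn; apply/funext => t; rewrite /Y mulr_sumr; apply: eq_bigr => j _; ring.
    have -> : Pn x Y = \sum_(j < m) u j * Pn x (h j).
      by rewrite /Y Pn_sum; apply: eq_bigr => j _; exact: PnZ.
    rewrite mulNr mulr_suml -sumrB; apply: eq_bigr => j _; ring.
  apply: (le_trans (ler_norm _)); apply: (le_trans (ler_norm_sum _ _ _)).
  rewrite mulrA /r mulr_sumr; apply: ler_sum => j _.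
  by rewrite normrM [leRHS]mulrC ler_wpM2l// noise_bound.
have H3 : nu ^+ 2 <= 5 / 4 * tau ^+ 2 * S2.
  by apply: (le_trans (Pn_cauchy_schwarz _ _ _)); rewrite ler_wpM2r.
have za : 1 - 2 * a <= 311/1000.
  have h1 : lam * r * (1 - 2 * a) <= lam * r * (311/1000).
    by lra.
  by rewrite ler_pM2l ?mulr_gt0 in h1.
(* From [rC - rS <= 311/1000 * (rC + rS)] one gets [rC <= 1311/689 * rS], well within 3. *)
have coneu : cone (supp bs) 3 u.
  rewrite /cone -/rS -/rC.
  have : r * (1 - 2 * a) <= r * (311/1000) by rewrite ler_pM2l.
  by rewrite aE rE; lra.
have rU0 : 0 < r * U by rewrite mulr_gt0.
pose y t := Y t / (r * U).
have bY : bounded_measurable Y.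
  apply: bounded_measurable_sum => j; apply: bounded_measurableZ; exact: bounded_measurable_h.
have y2E : (fun t => y t ^+ 2) = (fun t => (r ^+ 2 * U ^+ 2)^-1 * Y t ^+ 2).
  by apply/funext => t; rewrite /y; field; rewrite !gt_eqF.
have ruu : 0 < r ^+ 2 * U ^+ 2 by rewrite mulr_gt0 ?exprn_gt0.
have muE : PE P (fun t => y t ^+ 2) = (r ^+ 2 * U ^+ 2)^-1 * PE P (fun t => Y t ^+ 2).
  rewrite y2E /PE RintegralZl//.
  by apply: bounded_measurable_integrable; exact: bounded_measurableM.
have H6 : a ^+ 2 / xi <= PE P (fun t => y t ^+ 2).
  have h1 : gamma * (rS ^+ 2 / ell) <= PE P (fun t => Y t ^+ 2).
    rewrite /Y PE_sqr_lincomb; apply: le_trans (RE coneu).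
    rewrite ler_pM2l// ler_pdivrMr//.
    have cs : rS ^+ 2 <= ell * \sum_(j in supp bs) u j ^+ 2.
      exact: sqr_sum_norm_le.
    apply: (le_trans cs); rewrite mulrC ler_pM2r//.
    rewrite [leRHS](bigID (mem (supp bs)))/= lerDl sumr_ge0// => j _.
    exact: sqr_ge0.
  rewrite muE [leRHS]mulrC ler_pdivlMr//; apply: le_trans h1.
  rewrite le_eqVlt; apply/orP; left; apply/eqP; rewrite /a /xi; field.
  by rewrite !gt_eqF.
have H4 : Pn x (fun t => y t ^+ 2) * (r ^+ 2 * U ^+ 2) = S2 + Pn x Y ^+ 2.
  rewrite y2E PnZ mulrC mulrA divff ?gt_eqF// mul1r /S2 Pn_sum_sqr_center//.
  by rewrite subrK.
have H5 : Pn x Y ^+ 2 <= 2 * L / n%:R * (r ^+ 2 * U ^+ 2).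
  have := Pn_lincomb_le; rewrite -(ler_pXn2r (n := 2)) ?nnegrE//; last first.
    by rewrite !mulr_ge0 ?sqrtr_ge0// ltW.
  rewrite real_normK ?num_real// !exprMn sg2 sqr_sqrtr// => /le_trans; apply.
  rewrite le_eqVlt; apply/orP; left; apply/eqP; ring.
(* Positive and negative parts of [u] divided by its l1 norm: the Maurey weights on the signed
   control variates, without a case split on signs. *)
pose p (j : 'I_m * bool) := (`|u j.1| + (-1) ^+ j.2 * u j.1) / (2 * r).
have p0 j : 0 <= p j.
  rewrite /p divr_ge0 ?mulr_ge0 ?(ltW r0)//; have := ler_norm (u j.1).
  have := ler_norm (- u j.1); rewrite normrN; case: j.2; rewrite ?expr1 ?expr0; lra.
have sum2 (F : 'I_m * bool -> R) : \sum_j F j = \sum_(j < m) (F (j, true) + F (j, false)).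
  transitivity (\sum_j F (j.1, j.2)); first by apply: eq_bigr => -[].
  rewrite -(pair_bigA _ (fun i k => F (i, k)))/=.
  by apply: eq_bigr => j _; rewrite big_bool.
have p1 : \sum_j p j = 1.
  rewrite sum2 /p/=.
  transitivity (\sum_(j < m) `|u j| / r).
    by apply: eq_bigr => j _; field; rewrite gt_eqF.
  by rewrite -mulr_suml divff ?gt_eqF.
have signed1 j t : `|signed j t| <= 1.
  rewrite /signed !normrM normrX normrN1 expr1n mul1r normfV (gtr0_norm U0).
  by rewrite ler_pdivrMr// mul1r.
have bsig j : bounded_measurable (signed j).
  rewrite /signed; under eq_fun do rewrite mulrAC.
  by apply: bounded_measurableZ; exact: bounded_measurable_h.
have yE t : y t = \sum_j p j * signed j t.
  rewrite sum2 /y /Y mulr_suml; apply: eq_bigr => j _; rewrite /p /signed/= expr0 expr1.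
  by field; rewrite !gt_eqF.
have H7 : s * PE P (fun t => y t ^+ 2) <=
    kern_offset M s + kern_slope s * Pn x (fun t => y t ^+ 2) + b / n%:R.
  have h7 := empirical_quadratic_lower bsig M12 s01 yE p0 p1 signed1 E5.
  rewrite -(ler_pM2l nn); apply: (le_trans h7).
  rewrite le_eqVlt; apply/orP; left; apply/eqP; rewrite /Pn; field.
  by rewrite gt_eqF.
have s0 : 0 < s by case/andP: s01.
have m12 : 12 <= M%:R :> R by rewrite (ler_nat _ 12).
have c00 : 0 <= kern_offset M s.
  have D0 : 0 < M%:R ^+ 2 - M%:R :> R by rewrite expr2; nra.
  rewrite /kern_offset /kern_moment2 /kern_moment3 addr_ge0// !mulr_ge0 ?exprn_ge0 ?invr_ge0
    ?exprn_ge0 ?(ltW s0) ?(ltW D0)//.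
  by rewrite subr_ge0; lra.
apply: (l1_error_contradiction (n := n%:R) r0 lam0 U0 tau0 gamma0 ell0 L0 nn
  (erefl xi) erefl (erefl V) n1 n2 LL2 _ b1 b2 b0 s0 S20 K c00 H1 H2 H3 H4 H5 H6 H7).
have := lamL; rewrite -(ler_pXn2r (n := 2)) ?nnegrE ?(ltW lam0)//; last first.
  by rewrite !mulr_ge0 ?sqrtr_ge0// ltW.
apply: le_trans; rewrite !exprMn -/sg sg2 le_eqVlt; apply/orP; left; apply/eqP; ring.
Qed.
End lasso_error.

(** * Combining failure events *)

Section failure_probability.
Context {R : realType} {d : measure_display} {Omega : measurableType d}
  (Q : probability Omega R).

(* An event that need not be measurable: it suffices to cover its complement. *)
Definition fails_within (c : R) (G : Omega -> Prop) :=
  exists B : set Omega, [/\ measurable B, (Q B <= c%:E)%E & forall w, ~ B w -> G w].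

Lemma fails_withinI c1 c2 (G1 G2 : Omega -> Prop) :
  fails_within c1 G1 -> fails_within c2 G2 ->
  fails_within (c1 + c2) (fun w => G1 w /\ G2 w).
Proof.
move=> [B1 [m1 q1 g1]] [B2 [m2 q2 g2]]; exists (B1 `|` B2); split.
- exact: measurableU.
- by apply: (le_trans (measureU2 Q m1 m2)); rewrite EFinD; exact: leeD.
by move=> w /not_orP[n1 n2]; split; [exact: g1|exact: g2].
Qed.

Lemma fails_within_forall (I : finType) c (G : I -> Omega -> Prop) :
  (forall i, fails_within c (G i)) ->
  fails_within (#|I|%:R * c) (fun w => forall i, G i w).
Proof.
move=> /choice[B HB].
have mB i : measurable (B i) by have [] := HB i.
have QB i : (Q (B i) <= c%:E)%E by have [] := HB i.
have [A [mA QA nA]] := union_bound mB QB.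
exists A; split => //; first by rewrite mulr_natl -sumr_const.
by move=> w /nA nB i; have [_ _] := HB i; apply; exact: nB.
Qed.

Lemma fails_within_le c1 c2 G : c1 <= c2 -> fails_within c1 G -> fails_within c2 G.
Proof. by move=> c12 [B [mB QB gB]]; exists B; split => //; rewrite (le_trans QB). Qed.
End failure_probability.

Section square_integrable.
Context {R : realType} {d d' : measure_display} {T : measurableType d}
  {Omega : measurableType d'} (P : probability T R) (Q : probability Omega R).

(** Exceeding 5/4 tau^2 means a sum of [e^2 / (10 * tau^2)] above n/8 = 16n/128, while each factor
    has exponential moment sqrt(5/4) <= exp(15/128). *)
Lemma mean_square_deviation n (X : 'I_n -> Omega -> T) (e : T -> R) (tau : R) :
  iid_sample Q P X -> (0 < n)%N -> 0 < tau -> measurable_fun setT e ->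
  subgaussian P (tau ^+ 2) e ->
  fails_within Q (expR (- (n%:R / 128)))
    (fun w => Pn (X^~ w) (fun t => e t ^+ 2) <= 5 / 4 * tau ^+ 2).
Proof.
move=> iid n0 tau0 me sg.
have nn : 0 < n%:R :> R by rewrite ltr0n.
have t2 : 0 < tau ^+ 2 by rewrite exprn_gt0.
pose phi t := expR (e t ^+ 2 / (10 * tau ^+ 2)).
have mphi : measurable_fun setT phi.
  apply: measurableT_comp => //; apply: measurable_funM => //.
  exact: measurable_funX.
exists [set w | expR (n%:R / 8) <= \prod_(i < n) phi (X i w)]; split.
- exact: measurable_iid_prod_ge iid mphi.
- apply: (le_trans (iid_markov iid mphi (fun x => expR_ge0 _) (subgaussian_sqr tau0 me sg)
    (expR_gt0 _))).
  have K : Num.sqrt (5 / 4) <= expR (15 / 128) :> R.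
    have x0 : 0 <= expR (15 / 128) :> R by exact: expR_ge0.
    rewrite -[leRHS](ger0_norm x0) -sqrtr_sqr ler_sqrt ?sqr_ge0//.
    rewrite (_ : 15 / 128 = 4%:R * (15 / 512)); last by field.
    rewrite expRM_natl -exprM.
    apply: (@le_trans _ _ ((1 + 15 / 512) ^+ 8)); first lra.
    have h := expR_ge1Dx (15 / 512 : R).
    by apply: lerXn2r h; rewrite nnegrE; [lra|exact: expR_ge0].
  rewrite lee_fin ler_pdivrMr ?expR_gt0// -expRD.
  apply: (@le_trans _ _ (expR (15 / 128) ^+ n)).
    by rewrite lerXn2r ?nnegrE ?sqrtr_ge0 ?expR_ge0.
  rewrite -expRM_natl ler_expR le_eqVlt; apply/orP; left; apply/eqP; by field.
move=> w /negP; rewrite -ltNge /phi -expR_sum ltr_expR => h.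
rewrite /Pn -(ler_pM2l nn) mulrA divff ?gt_eqF// mul1r.
rewrite -mulr_suml ltr_pdivrMr ?mulr_gt0// in h.
apply: (le_trans (ltW h)); rewrite le_eqVlt; apply/orP; left; apply/eqP; by field.
Qed.

Lemma sqr_integrable_shift (f g : T -> R) (c : R) : measurable_fun setT f ->
  P.-integrable setT (fun x => (f x ^+ 2)%:E) -> bounded_measurable g ->
  P.-integrable setT (fun x => ((f x - c - g x) ^+ 2)%:E).
Proof.
move=> mf if2 bg.
have [mG [C GC]] : bounded_measurable (fun x => - c - g x).
  rewrite (_ : (fun x => _) = (fun x => cst (- c) x + (-1) * g x)); last first.
    by apply/funext => x; rewrite mulN1r.
  apply: bounded_measurableD; first exact: bounded_measurable_cst.
  exact: bounded_measurableZ.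
have E x : f x - c - g x = f x + (- c - g x) by rewrite addrA.
have i2 : P.-integrable setT (EFin \o (fun x => 2 * f x ^+ 2)).
  rewrite (_ : EFin \o _ = (fun x => (2%:E * (f x ^+ 2)%R%:E)%E)).
    exact: integrableZl.
  by apply/funext => x; rewrite /= EFinM.
have i3 : P.-integrable setT (EFin \o (cst (2 * C ^+ 2) : T -> R)).
  exact: (bounded_measurable_integrable P (bounded_measurable_cst _)).
apply: (@le_integrable _ _ _ P setT measurableT _
    (EFin \o (fun x => 2 * f x ^+ 2 + cst (2 * C ^+ 2) x))).
- apply/measurable_EFinP; apply: measurable_funX.
  by rewrite (funext E); exact: measurable_funD.
- move=> x _; have GG : (- c - g x) ^+ 2 <= C ^+ 2.
    rewrite -real_normK ?num_real// lerXn2r ?nnegrE// ?GC//.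
    by rewrite (le_trans _ (GC x)).
  have h : (f x - c - g x) ^+ 2 <= 2 * f x ^+ 2 + 2 * C ^+ 2.
    move: (- c - g x) (E x) GG => G -> GG; have := sqr_ge0 (f x - G).
    rewrite !sqrrD !sqrrN; lra.
  rewrite lee_fin ger0_norm ?sqr_ge0//; apply: (le_trans h).
  exact: ler_norm.
- exact: (integrableD measurableT i2 i3).
Qed.
End square_integrable.

(** * Constants and probabilities of the main bound *)

Lemma normr_le_Uh (T : Type) (R : realType) m (h : 'I_m -> T -> R) j t :
  h_bounded h -> `|h j t| <= Uh h.
Proof. by move=> hb; apply: ub_le_sup => //; exists (j, t). Qed.

(** [b] pays for the (2m)^M tuples and for a share delta/8. All claims become linear in ln 2, ln m
    and ln(1/delta), the first two being nonnegative and the last positive. *)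
Lemma log_budget (R : realType) (m M : nat) (delta : R) :
  (0 < m)%N -> (12 <= M)%N -> 0 < delta -> delta < 1 ->
  let L := ln (8 * m%:R / delta) in
  let L1 := ln (8 / delta) in
  let L2 := ln (8 * m%:R ^+ 2 / delta) in
  let b := M%:R * ln (2 * m%:R) + L1 in
  [/\ 0 < L1, L1 <= L & L <= L2] /\
  [/\ 0 <= b, b <= M%:R * L & b <= M%:R * L2 / 2].
Proof.
move=> m0 M12 d0 d1 /=.
have m1 : 0 < m%:R :> R by rewrite ltr0n.
have dV : 0 < delta^-1 by rewrite invr_gt0.
have l8 : ln 8 = 3 * ln 2 :> R.
  by rewrite (_ : 8 = 2 ^+ 3 :> R) ?lnXn// ?mulr_natl//; ring.
have p8 : (8 : R) \is Num.pos by rewrite posrE.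
have p2 : (2 : R) \is Num.pos by rewrite posrE.
have pm : (m%:R : R) \is Num.pos by rewrite posrE.
have pd : delta^-1 \is Num.pos by rewrite posrE.
rewrite !lnM ?posrE ?mulr_gt0 ?exprn_gt0// l8.
have l2 : 0 < ln 2 :> R by rewrite ln_gt0// ltr1n.
have lm : 0 <= ln m%:R :> R by rewrite ln_ge0// ler1n.
have ld : 0 < ln delta^-1 by rewrite ln_gt0// invf_gt1.
move: (ln 2) (ln m%:R) (ln delta^-1) l2 lm ld => x y z x0 y0 z0.
have MR : 12 <= M%:R :> R by rewrite ler_nat.
have Mx := ler_wpM2r (ltW x0) MR.
have My := ler_wpM2r y0 MR.
have Mz := ler_wpM2r (ltW z0) MR.
by split; split; lra.
Qed.

Section restricted_eigenvalue.
Context {R : realType} {d d' : measure_display} {T : measurableType d}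
  {Omega : measurableType d'} (P : probability T R) (Q : probability Omega R).

(** Tested on a coordinate vector in [S], which lies in the cone. It yields [xi >= 1] and excludes
    [U = 0]. *)
Lemma restricted_eigenvalue_le m (h : 'I_m -> T -> R) (S : {set 'I_m}) (gamma U : R) :
  (forall j, measurable_fun setT (h j)) -> (forall j t, `|h j t| <= U) ->
  (0 < #|S|)%N ->
  (forall u : 'I_m -> R, cone S 3 u ->
    gamma * \sum_(j < m) u j ^+ 2 <= \sum_(j < m) \sum_(k < m) u j * Gram P h j k * u k) ->
  gamma <= U ^+ 2.
Proof.
move=> mh hU /card_gt0P[j0 j0S] RE.
pose u (k : 'I_m) : R := (k == j0)%:R.
have D (F : 'I_m -> R) : \sum_(j < m) u j * F j = F j0.
  rewrite (bigD1 j0)//= big1 ?addr0 /u ?eqxx ?mul1r// => k /negbTE ->.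
  by rewrite mul0r.
have C : cone S 3 u.
  rewrite /cone big1 ?mulr_ge0 ?sumr_ge0// => k; rewrite finset.in_setC => kS.
  rewrite /u; case: eqP => [kj|]; first by rewrite kj j0S in kS.
  by rewrite normr0.
have := RE u C.
rewrite (eq_bigr (fun j => u j * u j)); last by move=> j _; rewrite expr2.
rewrite D {1}/u eqxx mulr1.
under eq_bigr do under eq_bigr do rewrite -mulrA.
under eq_bigr do rewrite -mulr_sumr.
rewrite D.
under eq_bigr do rewrite mulrC.
rewrite D => /le_trans; apply; rewrite /Gram.
have bh : bounded_measurable (h j0) by split => //; exists U.
rewrite -(PE_cst P (U ^+ 2)); apply: le_Rintegral => //.
- exact: (bounded_measurable_integrable P (bounded_measurableM bh bh)).
- exact: (bounded_measurable_integrable P (bounded_measurable_cst _)).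
move=> x _; rewrite -expr2 -real_normK ?num_real// lerXn2r ?nnegrE//.
by rewrite (le_trans _ (hU j0 x)).
Qed.
End restricted_eigenvalue.

Lemma sqrt_natV_mul (R : realType) (L : R) n : (0 < n)%N -> 0 <= L ->
  Num.sqrt (L / n%:R) = Num.sqrt L / Num.sqrt n%:R.
Proof. by move=> n0 L0; rewrite sqrtrM// sqrtrV. Qed.

(** The five shares are delta/4 three times and delta/8 twice, in the order of the events. *)
Lemma failure_budget (R : realType) (m M n : nat) (delta : R) :
  (0 < m)%N -> 0 < delta -> 128 * ln (8 * m%:R / delta) <= n%:R ->
  2 * expR (- ln (8 / delta)) +
  (m%:R * (2 * expR (- ln (8 * m%:R / delta))) +
  (m%:R * (2 * expR (- ln (8 * m%:R / delta))) +
  (expR (- (n%:R / 128)) +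
   (m%:R * 2) ^+ M * expR (- (M%:R * ln (2 * m%:R) + ln (8 / delta)))))) <= delta.
Proof.
move=> m0 d0 nL.
have m1 : 0 < m%:R :> R by rewrite ltr0n.
have m1' : 1 <= m%:R :> R by rewrite ler1n.
have e1 : expR (- ln (8 / delta)) = delta / 8.
  by rewrite expRN lnK ?invf_div// posrE divr_gt0.
have e2 : expR (- ln (8 * m%:R / delta)) = delta / (8 * m%:R).
  by rewrite expRN lnK ?invf_div// posrE divr_gt0// mulr_gt0.
have e3 : expR (- (n%:R / 128)) <= delta / 8.
  apply: (@le_trans _ _ (delta / (8 * m%:R))).
    by rewrite -e2 ler_expR lerN2 ler_pdivlMr// mulrC.
  rewrite ler_pM2l// lef_pV2 ?posrE ?mulr_gt0//; lra.
have e4 : (m%:R * 2) ^+ M * expR (- (M%:R * ln (2 * m%:R) + ln (8 / delta))) = delta / 8.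
  rewrite opprD expRD e1 expRN expRM_natl lnK ?posrE ?mulr_gt0//.
  rewrite (mulrC 2) mulrA divff ?mul1r// gt_eqF// exprn_gt0// mulr_gt0//.
have e5 : m%:R * (2 * (delta / (8 * m%:R))) = delta / 4.
  by field; rewrite gt_eqF.
rewrite e1 e2 e4 e5; lra.
Qed.

Lemma alpha_lasso_sub (T : Type) (R : realType) m n (x : 'I_n -> T) (f e : T -> R)
    (h : 'I_m -> T -> R) (bs bhat : 'I_m -> R) (c : R) : (0 < n)%N ->
  (forall t, e t = f t - c - \sum_(j < m) bs j * h j t) ->
  alpha_lasso x f h bhat - c =
  Pn x e - Pn x (fun t => \sum_(j < m) (bhat j - bs j) * h j t).
Proof.
move=> n0 eE; rewrite /alpha_lasso.
have -> : (fun t => f t - \sum_(j < m) bhat j * h j t) =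
    (fun t => e t + ((-1) * (\sum_(j < m) (bhat j - bs j) * h j t) + c)).
  apply/funext => t; rewrite eE.
  rewrite (_ : \sum_(j < m) (bhat j - bs j) * h j t =
      \sum_(j < m) bhat j * h j t - \sum_(j < m) bs j * h j t); first by ring.
  by rewrite -sumrB; apply: eq_bigr => j _; rewrite mulrBl.
by rewrite PnD PnD PnZ Pn_cst//; ring.
Qed.

Lemma error_rate (R : realType) (tau gamma U lam ell L L1 r z y : R) n :
  (0 < n)%N -> 0 < tau -> 0 < gamma -> 0 < U -> 0 <= lam -> 0 <= ell -> 0 <= L ->
  0 <= L1 ->
  `|z| <= Num.sqrt (2 * tau ^+ 2 * L1 / n%:R) ->
  `|y| <= r * (Num.sqrt 2 * U * Num.sqrt (L / n%:R)) ->
  r <= 48 * lam * ell / gamma ->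
  `|z - y| <= Num.sqrt (2 * L1) * tau / Num.sqrt n%:R
    + 68 * lam * ell * Num.sqrt L * (U / gamma) / Num.sqrt n%:R.
Proof.
move=> n0 tau0 g0 U0 lam0 ell0 L0 L10 hz hy hr.
have nn : 0 < n%:R :> R by rewrite ltr0n.
have sn : 0 < Num.sqrt n%:R :> R by rewrite sqrtr_gt0.
apply: (le_trans (ler_normB _ _)); apply: lerD.
  apply: (le_trans hz); rewrite (_ : _ * L1 = tau ^+ 2 * (2 * L1)); last by ring.
  have LL : 0 <= tau ^+ 2 * (2 * L1) by rewrite mulr_ge0 ?sqr_ge0// mulr_ge0.
  rewrite sqrt_natV_mul// sqrtrM ?sqr_ge0// sqrtr_sqr gtr0_norm//.
  by rewrite (mulrC tau).
apply: (le_trans hy); rewrite sqrt_natV_mul//.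
set q := Num.sqrt L; set p := Num.sqrt n%:R; set w := Num.sqrt 2.
have q0 : 0 <= q by exact: sqrtr_ge0.
have w0 : 0 <= w by exact: sqrtr_ge0.
have w2 : 48 * w <= 68.
  have ww : w ^+ 2 = 2 by rewrite sqr_sqrtr.
  rewrite leNgt; apply/negP => h.
  have : 0 < (48 * w - 68) * (48 * w + 68) by rewrite mulr_gt0; lra.
  lra.
have a0 : 0 <= w * U * (q / p) by rewrite !mulr_ge0 ?invr_ge0// ltW.
apply: (le_trans (ler_wpM2r a0 hr)).
have -> : 48 * lam * ell / gamma * (w * U * (q / p)) =
    48 * w * (lam * ell * q * (U / gamma) / p) by field; rewrite !gt_eqF.
have -> : 68 * lam * ell * q * (U / gamma) / p =
    68 * (lam * ell * q * (U / gamma) / p) by field; rewrite !gt_eqF.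
apply: ler_wpM2r w2; rewrite !mulr_ge0 ?invr_ge0// ltW//.
Qed.

Lemma error_rate_tuned (R : realType) (tau gamma U ell L : R) n :
  (0 < n)%N -> 0 < gamma -> 0 <= L ->
  68 * (7 * U * Num.sqrt L * tau / Num.sqrt n%:R) * ell * Num.sqrt L
    * (U / gamma) / Num.sqrt n%:R =
  476 * ell * L * (U ^+ 2 / gamma) * tau / n%:R.
Proof.
move=> n0 g0 L0.
have nn : 0 < n%:R :> R by rewrite ltr0n.
have sn : 0 < Num.sqrt n%:R :> R by rewrite sqrtr_gt0.
have [pE qE] := (sqr_sqrtr (ltW nn), sqr_sqrtr L0).
move: (Num.sqrt n%:R) (Num.sqrt L) sn pE qE => p q p0 <- <-.
by field; rewrite !gt_eqF.
Qed.

Unset Implicit Arguments. Set Strict Implicit.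

Theorem theorem2 (R : realType) (d d' : measure_display)
  (T : measurableType d) (P : probability T R)
  (Omega : measurableType d') (Q : probability Omega R)
  (m : nat) (f : T -> R) (h : 'I_m -> T -> R)
  (f_meas : measurable_fun setT f)
  (f_L2 : P.-integrable setT (fun x => (f x ^+ 2)%:E))
  (h_meas : forall j, measurable_fun setT (h j))
  (h_L2 : forall j, P.-integrable setT (fun x => (h j x ^+ 2)%:E))
  (h_centered : forall j, PE P (h j) = 0)
  (beta_star : 'I_m -> R)
  (beta_star_min : forall beta : 'I_m -> R,
     (\int[P]_x ((f x - PE P f - \sum_(j < m) beta_star j * h j x) ^+ 2)%:E
      <= \int[P]_x ((f x - PE P f - \sum_(j < m) beta j * h j x) ^+ 2)%:E)%E)
  (S_nonempty : (0 < #|supp beta_star|)%N)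
  (tau : R) (tau_pos : 0 < tau)
  (eps_subG : subgaussian P (tau ^+ 2)
     (fun x => f x - PE P f - \sum_(j < m) beta_star j * h j x))
  (h_bnd : h_bounded h)
  (gamma : R) (gamma_pos : 0 < gamma)
  (RE : forall u : 'I_m -> R, cone (supp beta_star) 3 u ->
     \sum_(j < m) \sum_(k < m) u j * Gram P h j k * u k
       >= gamma * \sum_(j < m) u j ^+ 2)
  (delta : R) (delta_pos : 0 < delta) (delta_lt1 : delta < 1)
  (n : nat) (X : 'I_n -> Omega -> T) (X_iid : iid_sample Q P X)
  (lam : R) :
  let ell := (#|supp beta_star|)%:R : R in
  let U := Uh h in
  let xi := ell * U ^+ 2 / gamma in
  n%:R >= Num.max (8 * xi ^+ 2 * ln (8 * m%:R ^+ 2 / delta))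
                  (128 * xi * ln (8 * m%:R / delta)) ->
  lam >= 7 * U * Num.sqrt (ln (8 * m%:R / delta)) * tau / Num.sqrt n%:R ->
  exists E : set Omega, [/\ measurable E, (Q E >= (1 - delta)%:E)%E &
    forall w, E w ->
    forall bhat : 'I_m -> R,
      lasso_minimizer (fun i => X i w) f h lam bhat ->
      `|alpha_lasso (fun i => X i w) f h bhat - PE P f|
        <= Num.sqrt (2 * ln (8 / delta)) * tau / Num.sqrt n%:R
           + 68 * lam * ell * Num.sqrt (ln (8 * m%:R / delta))
             * (U / gamma) / Num.sqrt n%:R
      /\
      (lam = 7 * U * Num.sqrt (ln (8 * m%:R / delta)) * tau / Num.sqrt n%:R ->
       `|alpha_lasso (fun i => X i w) f h bhat - PE P f|
        <= Num.sqrt (2 * ln (8 / delta)) * tau / Num.sqrt n%:R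
           + 476 * ell * ln (8 * m%:R / delta) * (U ^+ 2 / gamma) * tau / n%:R)].
Proof.
move=> ell U xi; rewrite ge_max => /andP[n2 n1] hlam.
have m0 : (0 < m)%N.
  by have /card_gt0P[j _] := S_nonempty; exact: leq_ltn_trans (leq0n _) (ltn_ord j).
have hU j t : `|h j t| <= U by exact: normr_le_Uh.
have gU : gamma <= U ^+ 2 := restricted_eigenvalue_le h_meas hU S_nonempty RE.
have U0 : 0 < U.
  have Un0 : U != 0.
    by apply/eqP => U0; move: gU; rewrite U0 expr0n/= leNgt gamma_pos.
  (* Nonnegativity of the supremum needs a point of [T], which exists because [P] has mass 1. *)
  rewrite lt_def Un0/=; have [T0|/set0P[t _]] := eqVneq (setT : set T) set0.
    have := probability_setT P; rewrite T0 measure0 => /eqP.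
    by rewrite eqe eq_sym oner_eq0.
  exact: le_trans (normr_ge0 _) (hU (Ordinal m0) t).
have U20 : 0 < U ^+ 2 by rewrite exprn_gt0.
have t20 : 0 < tau ^+ 2 by rewrite exprn_gt0.
have ell1 : 1 <= ell by rewrite ler1n.
have xi1 : 1 <= xi.
  rewrite /xi ler_pdivlMr// mul1r; apply: (le_trans gU).
  by rewrite ler_peMl// ltW.
have [[L10 L1L LL2] _] := log_budget m0 (leqnn 12) delta_pos delta_lt1.
set L := ln (8 * m%:R / delta) in n1 hlam L1L LL2 *.
set L1 := ln (8 / delta) in L10 L1L *.
set L2 := ln (8 * m%:R ^+ 2 / delta) in n2 LL2 *.
have L0 : 0 < L by exact: lt_le_trans L1L.
have xi0 : 0 < xi by exact: lt_le_trans xi1.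
have nL : 128 * L <= n%:R.
  by apply: le_trans n1; rewrite -[leRHS]mulrA ler_pM2l// ler_peMl// (ltW L0).
have n0 : (0 < n)%N by rewrite -(ltr0n R); apply: lt_le_trans nL; rewrite mulr_gt0.
have V128 : 128 <= Num.max (n%:R / (xi * L)) (16 * xi).
  have xL0 : 0 < xi * L by exact: mulr_gt0.
  by rewrite le_max (ler_pdivlMr _ _ xL0) [128 * _]mulrA n1.
have [M [s [M12 s01 K]]] := kernel_parameters V128.
have [_ []] := log_budget m0 M12 delta_pos delta_lt1.
rewrite -/L -/L1 -/L2; set b := _ + L1 => b0 b1 b2.
pose Y x := \sum_(j < m) beta_star j * h j x.
have bh j : bounded_measurable (h j) by split => //; exists U.
have bY : bounded_measurable Y.
  by apply: bounded_measurable_sum => j; exact: bounded_measurableZ.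
pose e x := f x - PE P f - Y x.
have me : measurable_fun setT e.
  by apply: measurable_funB; [exact: measurable_funB|case: bY].
have ie2 : P.-integrable setT (fun x => (e x ^+ 2)%:E) := sqr_integrable_shift _ f_meas f_L2 bY.
have orth j : P.-integrable setT (EFin \o (fun x => h j x * e x)) /\
    PE P (fun x => h j x * e x) = 0.
  apply: (square_minimizer_orthogonal me (h_meas j) ie2 (hU j)) => t.
  (* Moving only coordinate [j] subtracts [t * h j] from the residual. *)
  apply: (le_trans (beta_star_min (fun k => beta_star k + t * (k == j)%:R))).
  rewrite le_eqVlt; apply/orP; left; apply/eqP; apply: eq_integral => x _.
  congr ((_ ^+ 2)%:E).
  rewrite (_ : \sum_(k < m) _ = Y x + t * h j x); first by rewrite /e; ring.
  rewrite (eq_bigr (fun k => beta_star k * h k x + (k == j)%:R * (t * h k x))); last first.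
    by move=> k _; ring.
  rewrite big_split/=; congr (_ + _).
  by rewrite (bigD1 j)//= eqxx mul1r big1 ?addr0// => k /negbTE ->; rewrite mul0r.
pose signed (j : 'I_m * bool) (t : T) : R := (-1) ^+ j.2 * h j.1 t / U.
have bsg j : bounded_measurable (signed j).
  rewrite (_ : signed j = (fun t => ((-1) ^+ j.2 / U) * h j.1 t)).
    exact: bounded_measurableZ.
  by apply/funext => t; rewrite /signed mulrAC.
have sg1 j x : `|signed j x| <= 1.
  by rewrite /signed normrM normrM normr_sign mul1r normfV (gtr0_norm U0) ler_pdivrMr// mul1r.
have F1 := subgaussian_deviation X_iid n0 me t20 L10 eps_subG.
have F2 : fails_within Q _ _ := fails_within_forall (fun j => subgaussian_deviation X_iid n0
  (h_meas j) U20 L0 (fun l => mgf_bounded l (h_meas j) U0 (hU j) (h_centered j))).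
have mhe j : measurable_fun setT (fun x => h j x * e x) by exact: measurable_funM.
have v0 : 0 < 2 * (U ^+ 2 * tau ^+ 2) by rewrite !mulr_gt0.
have F3 : fails_within Q _ _ := fails_within_forall (fun j => subgaussian_deviation X_iid n0
  (mhe j) v0 L0 (fun l => mgf_bounded_mul l (h_meas j) me U0 (hU j) eps_subG
    (orth j).1 (orth j).2)).
have F4 := mean_square_deviation X_iid n0 tau_pos me eps_subG.
(* [M] and [s] depend only on deterministic quantities, so the tuples form a fixed family; the
   weights, which depend on [bhat], come in only after this event. *)
have F5 : fails_within Q _ _ := fails_within_forall (fun l : M.-tuple ('I_m * bool) =>
  kernel_event X_iid bsg sg1 b M12 s01 (size_tuple l)).
have := fails_withinI F1 (fails_withinI F2 (fails_withinI F3 (fails_withinI F4 F5))).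
rewrite card_tuple card_prod card_ord card_bool natrX natrM.
move=> /(fails_within_le (failure_budget M m0 delta_pos nL))[B [mB QB gB]].
exists (~` B); split; first exact: measurableC.
  by rewrite probability_setC// EFinB leeB.
move=> w /gB[E1 [E2 [E3 [E4 E5]]]] bhat hmin.
have lamL : 7 * U * tau * Num.sqrt (L / n%:R) <= lam.
  by rewrite (sqrt_natV_mul n0 (ltW L0)) mulrA (mulrAC _ tau).
have lam0 : 0 <= lam by apply: le_trans lamL; rewrite !mulr_ge0 ?sqrtr_ge0 ?(ltW U0) ?ltW.
have eE t : e t = f t - PE P f - \sum_(j < m) beta_star j * h j t by [].
have r48 := lasso_l1_error n0 h_meas hU U0 tau_pos gamma_pos L0 L1L LL2 eE
  S_nonempty RE n1 n2 xi1 lamL M12 s01 K b0 b1 b2 E1 E2 E3 E4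
  (fun l (lM : size l = M) => E5 (Tuple (introT eqP lM))) hmin.
have hy := Pn_lincomb_le beta_star U0 E2 bhat.
have main := error_rate n0 tau_pos gamma_pos U0 lam0 (le_trans ler01 ell1) (ltW L0)
  (ltW L10) E1 hy r48.
rewrite (alpha_lasso_sub _ bhat n0 eE); split => // lamE.
by apply: (le_trans main); rewrite lerD2l lamE error_rate_tuned// ltW.
Qed.
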